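(* For indeterminates $t,u,x_1,\dots,x_{2n}$, $$\sum_{\lambda}\ \prod_{\substack{j\in\{2,4,6,\dots\}\\ j\le m_0(\lambda)}}(1-ut^{j-2})\ b^{\rm el}_\lambda(t)\,P_\lambda(x_1,\dots,x_{2n};t)=\prod_{1\le i<j\le 2n}\frac{1-tx_ix_j}{x_i-x_j}\ \mathop{\rm Pf}_{1\le i<j\le 2n}\left[\frac{(x_i-x_j)(1-u+(u-t)x_ix_j)}{(1-x_ix_j)(1-tx_ix_j)}\right],$$ where the sum runs over all partitions $\lambda$ of length at most $2n$ whose conjugate $\lambda'$ has only even parts.
   Context: $P_\lambda(\cdot;t)$ denotes the Hall–Littlewood polynomial (Macdonald's normalization). $m_0(\lambda)=2n-\ell(\lambda)$, and for $i\ge1$, $m_i(\lambda)$ is the number of parts equal to $i$. $b^{\rm el}_\lambda(t)=\prod_{i\ge1}\prod_{j\in\{2,4,\dots\},\,j\le m_i(\lambda)}(1-t^{j-1})$. Empty products are $1$. $\mathop{\rm Pf}$ denotes the Pfaffian of the antisymmetric matrix with the given upper-triangular entries. Identity of formal power series. *)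

(* Defs.v *)
(* MathComp with multinomials; classical choice (boolp) only provides decidable
   equality, choice and inverses on the type of formal power series. *)
From HB Require Import structures.
From mathcomp Require Import all_boot all_order all_fingroup all_algebra.
From mathcomp Require Import mpoly boolp.

Set Implicit Arguments.
Unset Strict Implicit.
Unset Printing Implicit Defensive.

Import Order.TTheory GRing.Theory.
Local Open Scope ring_scope.

(* The ring R[[x_0, ..., x_(n-1)]]; a series is its family of coefficients. *)
Record mps (n : nat) (R : Type) := Mps { pscoef : 'X_{1..n} -> R }.

Lemma mpsP (n : nat) (R : Type) (f g : mps n R) :
  (forall m, pscoef f m = pscoef g m) -> f = g.
Proof. by case: f g => [f] [g] /= fg; congr Mps; apply/funext. Qed.

HB.instance Definition _ (n : nat) (R : Type) := gen_eqMixin (mps n R).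
HB.instance Definition _ (n : nat) (R : Type) := gen_choiceMixin (mps n R).

Section MpsRing.
Variables (n : nat) (R : comNzRingType).
Implicit Types (f g h : mps n R) (m : 'X_{1..n}).

Definition mps_zero : mps n R := Mps (fun=> 0).
Definition mps_opp f := Mps (fun m => - pscoef f m).
Definition mps_add f g := Mps (fun m => pscoef f m + pscoef g m).

Fact mps_addA : associative mps_add.
Proof. by move=> f g h; apply/mpsP => m /=; rewrite addrA. Qed.
Fact mps_addC : commutative mps_add.
Proof. by move=> f g; apply/mpsP => m /=; rewrite addrC. Qed.
Fact mps_add0 : left_id mps_zero mps_add.
Proof. by move=> f; apply/mpsP => m /=; rewrite add0r. Qed.
Fact mps_addN : left_inverse mps_zero mps_opp mps_add.
Proof. by move=> f; apply/mpsP => m /=; rewrite addNr. Qed.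

HB.instance Definition _ :=
  GRing.isZmodule.Build (mps n R) mps_addA mps_addC mps_add0 mps_addN.

Definition mpsC (c : R) : mps n R := Mps (fun m => c *+ (m == 0%MM)).

Definition mpsX (i : 'I_n) : mps n R := Mps (fun m => (m == U_(i)%MM)%:R).

Definition mps_mul f g : mps n R := Mps (fun m =>
  \sum_(k : 'X_{1..n < (mdeg m).+1, (mdeg m).+1} | m == (k.1 + k.2)%MM)
    pscoef f k.1 * pscoef g k.2).

Definition mps_trunc d f : {mpoly R[n]} :=
  \sum_(k : 'X_{1..n < d}) pscoef f k *: 'X_[k].

Lemma mps_truncE d f m : (mdeg m < d)%N -> (mps_trunc d f)@_m = pscoef f m.
Proof. by move=> lt_md; rewrite mcoeff_mpoly. Qed.

Lemma mps_mulE f g (p q : {mpoly R[n]}) m :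
    (forall k, (mdeg k <= mdeg m)%N -> p@_k = pscoef f k) ->
    (forall k, (mdeg k <= mdeg m)%N -> q@_k = pscoef g k) ->
  pscoef (mps_mul f g) m = (p * q)@_m.
Proof.
move=> pf qg; rewrite mcoeffM /=; apply: eq_bigr => k _.
by rewrite pf ?qg //; have /= := bmdeg k.1; have /= := bmdeg k.2; rewrite !ltnS.
Qed.

Lemma mps_mul_trunc d f g m : (mdeg m < d)%N ->
  pscoef (mps_mul f g) m = (mps_trunc d f * mps_trunc d g)@_m.
Proof.
by move=> lt_md; apply: mps_mulE => k le_km;
  rewrite mps_truncE // (leq_ltn_trans le_km).
Qed.

Fact mps_mulA : associative mps_mul.
Proof.
move=> f g h; apply/mpsP => m; pose d := (mdeg m).+1.
rewrite (@mps_mulE _ _ (mps_trunc d f) (mps_trunc d g * mps_trunc d h)).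
- rewrite (@mps_mulE _ _ (mps_trunc d f * mps_trunc d g) (mps_trunc d h)).
  + by rewrite mulrA.
  + by move=> k le_km; rewrite -mps_mul_trunc.
  + by move=> k le_km; rewrite mps_truncE.
- by move=> k le_km; rewrite mps_truncE.
- by move=> k le_km; rewrite -mps_mul_trunc.
Qed.

Fact mps_mulC : commutative mps_mul.
Proof. by move=> f g; apply/mpsP => m; rewrite !(mps_mul_trunc _ _ (ltnSn _)) mulrC. Qed.

Fact mps_mul1 : left_id (mpsC 1) mps_mul.
Proof.
move=> f; apply/mpsP => m.
rewrite (@mps_mulE _ _ 1 (mps_trunc (mdeg m).+1 f)).
- by rewrite mul1r mps_truncE.
- by move=> k _; rewrite mcoeff1.
- by move=> k le_km; rewrite mps_truncE.
Qed.

Fact mps_mulDl : left_distributive mps_mul mps_add.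
Proof.
move=> f g h; apply/mpsP => m /=; rewrite -big_split /=.
by apply: eq_bigr => k _; rewrite mulrDl.
Qed.

Fact mps_oner_neq0 : mpsC 1 != mps_zero.
Proof.
apply/eqP => /(congr1 (fun f => pscoef f 0%MM)) /=.
by rewrite eqxx; apply/eqP/oner_neq0.
Qed.

HB.instance Definition _ := GRing.Zmodule_isComNzRing.Build (mps n R)
  mps_mulA mps_mulC mps_mul1 mps_mulDl mps_oner_neq0.

Definition mps_unit : {pred mps n R} := fun f => `[< exists g, g * f = 1 >].

Definition mps_inv f : mps n R :=
  if pselect (exists g, g * f = 1) is left fV then projT1 (cid fV) else f.

Fact mps_mulVf : {in mps_unit, left_inverse 1 mps_inv *%R}.
Proof.
by move=> f /asboolP fV; rewrite /mps_inv; case: pselect => // ?; case: cid.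
Qed.

Fact mps_unitPl f g : g * f = 1 -> mps_unit f.
Proof. by move=> gf; apply/asboolP; exists g. Qed.

Fact mps_inv_out : {in [predC mps_unit], mps_inv =1 id}.
Proof. by move=> f /asboolPn fNV; rewrite /mps_inv; case: pselect. Qed.

HB.instance Definition _ := GRing.ComNzRing_hasMulInverse.Build (mps n R)
  mps_mulVf mps_unitPl mps_inv_out.

End MpsRing.

Section MpsIdomain.
Variables (n : nat) (R : idomainType).

Lemma mps_lowest (f : mps n R) : f != 0 ->
  exists2 m, pscoef f m != 0 & forall k, (k < m)%O -> pscoef f k = 0.
Proof.
move=> nz_f; apply: contrapT => noleast; move/eqP: nz_f; apply; apply/mpsP.
elim/(ltmwf (n := n)) => m IHm; apply: contrapT => /eqP nz_fm.
by apply: noleast; exists m.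
Qed.

Fact mps_idomainAxiom (f g : mps n R) : f * g = 0 -> (f == 0) || (g == 0).
Proof.
move=> fg0; apply: contrapT => /negP; rewrite negb_or => /andP[nz_f nz_g].
have [a nz_fa lt_fa] := mps_lowest nz_f.
have [b nz_gb lt_gb] := mps_lowest nz_g.
have := congr1 (fun h => pscoef h (a + b)%MM) fg0.
have lt_ad : (mdeg a < (mdeg (a + b)%MM).+1)%N by rewrite ltnS mdegD leq_addr.
have lt_bd : (mdeg b < (mdeg (a + b)%MM).+1)%N by rewrite ltnS mdegD leq_addl.
rewrite /= (bigD1 (BMultinom lt_ad, BMultinom lt_bd)) //= big1 => [|k].
  by rewrite addr0; apply/eqP/mulf_neq0.
case/andP=> /eqP abk neq_k.
case: (ltgtP (k.1 : 'X_{1..n}) a) => [/lt_fa->|lt_ak|eq_ka]; first by rewrite mul0r.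
- case: (ltP (k.2 : 'X_{1..n}) b) => [/lt_gb->|le_bk]; first by rewrite mulr0.
  by move: (ltmc_le_add lt_ak le_bk); rewrite -[X in (_ < X)%O]abk ltxx.
- have eq_kb : (k.2 : 'X_{1..n}) = b.
    by apply/eqP; rewrite -(eqm_add2l a) -{1}eq_ka -abk.
  case/negP: neq_k; apply/eqP; case: (k) eq_ka eq_kb => k1 k2 /= eq1 eq2.
  by congr (_, _); apply/val_inj.
Qed.

HB.instance Definition _ :=
  GRing.ComUnitRing_isIntegral.Build (mps n R) mps_idomainAxiom.

End MpsIdomain.

(* S is the sum of the (F i)_(P i) in the sense of formal power series: the F i
   and S lie in the subring of power series of its fraction field, and each
   coefficient of S is the eventual value of that of the finite partial sums. *)
Definition formal_sum (n : nat) (R : idomainType) (I : eqType) (P : pred I)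
    (F : I -> {fraction mps n R}) (S : {fraction mps n R}) : Prop :=
  exists (f : I -> mps n R) (s : mps n R),
    [/\ forall i, P i -> tofrac (f i) = F i,
        tofrac s = S
      & forall m : 'X_{1..n}, exists A : seq I, forall B : seq I,
          uniq B -> {subset A <= B} ->
          \sum_(i <- B | P i) pscoef (f i) m = pscoef s m].

(* A partition is the weakly decreasing sequence of its nonzero parts. *)
Definition is_partition (l : seq nat) : bool := sorted geq l && (0%N \notin l).

Definition conj_partition (l : seq nat) : seq nat :=
  [seq count (fun p => i < p)%N l | i <- iota 0 (head 0%N l)].

(* The multiplicity m_i(l), where l is padded with zeros up to length N. *)
Definition mult (N : nat) (l : seq nat) (i : nat) : nat :=
  if i == 0%N then (N - size l)%N else count_mem i l.

Section HallLittlewood.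
Variable K : fieldType.

Definition hl_v (t : K) (m : nat) : K :=
  \prod_(1 <= i < m.+1) ((1 - t ^+ i) / (1 - t)).

(* P_l(x_0, ..., x_(N-1); t) for a partition l of length at most N, as
   symmetrized rational expression (Macdonald, Symmetric Functions and Hall
   Polynomials, III.2). Multiplicities vanish beyond the largest part head 0 l,
   which bounds the product over i. *)
Definition hall_littlewood (N : nat) (x : 'I_N -> K) (t : K) (l : seq nat) : K :=
  (\prod_(0 <= i < (head 0%N l).+1) hl_v t (mult N l i))^-1 *
  \sum_(w : 'S_N)
    ((\prod_(i < N) x (w i) ^+ nth 0%N l i) *
     \prod_(i < N) \prod_(j < N | (i < j)%N)
       ((x (w i) - t * x (w j)) / (x (w i) - x (w j)))).

Definition b_el (t : K) (l : seq nat) : K :=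
  \prod_(1 <= i < (head 0%N l).+1)
    \prod_(2 <= j < (count_mem i l).+1 | ~~ odd j) (1 - t ^+ (j - 1)).

End HallLittlewood.

Section Pfaffian.
Variable R : comNzRingType.

(* The sum over perfect matchings of {0, ..., 2n-1}, each represented by the
   permutation s with pairs {s 0, s 1}, {s 2, s 3}, ... such that
   s 0 < s 1, s 2 < s 3, ... and s 0 < s 2 < s 4 < ...; on an even index k,
   the cyclic successor ordS k is k + 1. *)
Definition pfaffian (n : nat) (A : 'M[R]_(2 * n)) : R :=
  \sum_(s : 'S_(2 * n) |
      [forall k : 'I_(2 * n), ~~ odd k ==> (s k < s (ordS k))%N] &&
      [forall k : 'I_(2 * n), forall l : 'I_(2 * n),
         [&& ~~ odd k, ~~ odd l & (k < l)%N] ==> (s k < s l)%N])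
    (-1) ^+ s * \prod_(k < 2 * n | ~~ odd k) A (s k) (s (ordS k)).

Definition antisym_mx (N : nat) (a : 'I_N -> 'I_N -> R) : 'M[R]_N :=
  \matrix_(i, j) (if (i < j)%N then a i j else if (j < i)%N then - a j i else 0).

End Pfaffian.

(* The field Q(t, u): t is the inner polynomial variable, u the outer one. *)
Definition Qtu : fieldType := {fraction {poly {poly rat}}}.

(* The fraction field of Q(t, u)[[x_0, ..., x_(N-1)]], and its indeterminates. *)
Definition Fxtu (N : nat) : fieldType := {fraction mps N Qtu}.

Definition t_ (N : nat) : Fxtu N := tofrac (mpsC N (tofrac ('X%:P) : Qtu)).
Definition u_ (N : nat) : Fxtu N := tofrac (mpsC N (tofrac 'X : Qtu)).
Definition x_ (N : nat) (i : 'I_N) : Fxtu N := tofrac (mpsX Qtu i).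

(* Main.v *)
(** For a set T of variables and a sequence beta, let F_beta(T) be the sum over
    S in T of beta_(|T|-|S|) prod_(i in S, j in T-S) (x_i - t x_j)/(x_i - x_j)
    prod_(i<j in S) (1 - t x_i x_j)/(1 - x_i x_j).  If
    beta_(r+2) = -(1 + t^(r+1)) beta_(r+1) - u t^r beta_r, then for |T| even
    F_beta(T) satisfies, as a rational function of one variable z in T, the same
    expansion as the Pfaffian along a row.  With denominators cleared, the two
    sides of that expansion are polynomials of degree 2(|T|-1) in z; with the
    other variables x_k, both vanish at z = x_k, both reduce to T - {z, x_k} at
    z = 1/x_k, and both are -u t^(|T|-2) F_beta(T - {z, x_k}), up to the cleared
    denominators, at z = 1/(t x_k).  So F_beta(T) is the right-hand side R_T(u).

    Composing the kernels gives R_T(u) = sum over S in T with |S| even of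
    prod_(i < |T-S|/2) (1 - u t^(2i))
    prod_(i in S, j in T-S) (x_i - t x_j)/(x_i - x_j) R_S(1), and
    R_S(1) = (prod_(i in S) x_i) R_S(t).  Removing the first column of each
    partition, S indexing the variables of the nonzero parts, gives the same
    recursion for the partial sums over partitions with at most d columns.  Hence
    R_T(u) minus the d-th partial sum has order at least d, by induction on d. *)

From HB Require Import structures.
Require Import Defs.
From mathcomp Require Import all_boot all_order all_fingroup all_algebra.
From mathcomp Require Import mpoly boolp ring zify.

Set Implicit Arguments.
Unset Strict Implicit.
Unset Printing Implicit Defensive.

Import GRing.Theory.
Local Open Scope ring_scope.

(** For |T| even, beta_0 = 1 and the recursion determine F_beta(T), whatever beta_1 is. This freedom
    is used to take for beta a convolution, with Gaussian binomials, of the solution for u = 1 with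
    the sequence prod (1 - u t^(2i)) on even indices and 0 on odd ones; the convolution is what
    turns F_beta(T) into a composition of kernels. The recursion itself is dictated by the node z =
    1/(t x_k), where 1 + t^(r+1) arises as [r+2]_t - t [r]_t.

    The obstacle is that the kernels (x_i - t x_j)/(x_i - x_j) are not power series, while both
    F_beta and P_lambda are sums of products of them. Orders are therefore measured in the fraction
    field, by a valuation that gives every kernel order at least 0; a nonempty S then gains an order
    from prod x_i. Such an estimate does not show that a single term is a power series, as a formal
    sum requires. For this the alternating numerator of P_lambda is divided by the Vandermonde
    product. *)

(** * Induction and sums over finite sets *)

Lemma set_ind_card (I : finType) (P : {set I} -> Prop) :
  P set0 -> (forall a (A : {set I}), a \notin A -> P A -> P (a |: A)) -> forall A, P A.
Proof.
move=> P0 PU A; have [n] := ubnP #|A|; elim: n A => // n IHn A lt_An.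
have [->//|[a aA]] := set_0Vmem A.
rewrite -(setD1K aA); apply: PU; first by rewrite !inE eqxx.
by apply: IHn; rewrite (cardsD1 a) aA in lt_An.
Qed.

Lemma setU1D1 (I : finType) (a : I) (A : {set I}) :
  a \notin A -> (a |: A) :\ a = A.
Proof.
move=> aA; apply/setP=> j; rewrite !inE; case: eqVneq => [->|] //=.
by rewrite (negPf aA).
Qed.

Lemma setU1D1_neq (I : finType) (a b : I) (A : {set I}) :
  a != b -> (a |: A) :\ b = a |: (A :\ b).
Proof.
move=> ab; apply/setP=> j; rewrite !inE.
by case: (eqVneq j b) => [->|] //=; rewrite eq_sym (negPf ab).
Qed.

Lemma big_subset_setU1 (R : nmodType) (I : finType) (a : I) (A : {set I})
    (F : {set I} -> R) : a \notin A ->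
  \sum_(S : {set I} | S \subset a |: A) F S =
  \sum_(S : {set I} | S \subset A) (F S + F (a |: S)).
Proof.
move=> aA; rewrite big_split /= (bigID (fun S : {set I} => a \in S)) /= addrC.
congr (_ + _).
  apply: eq_bigl => S; apply/andP/idP => [[SA aS]|SA].
    apply/subsetP => j jS; have := subsetP SA _ jS.
    by rewrite !inE => /predU1P[eja|//]; rewrite -eja jS in aS.
  split; first exact: subset_trans SA (subsetUr _ _).
  by apply: contra aA => /(subsetP SA).
rewrite (reindex_onto (fun S => a |: S) (fun S => S :\ a)) /=; last first.
  by move=> S /andP[_ aS]; rewrite setD1K.
apply: eq_bigl => S; rewrite !inE eqxx andbT /=.
apply/andP/idP => [[SA /eqP eS]|SA].
  have aS : a \notin S by rewrite -eS !inE eqxx.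
  apply/subsetP => j jS; have := subsetP SA j; rewrite !inE jS orbT.
  by move=> /(_ isT)/predU1P[eja|//]; rewrite -eja jS in aS.
split; first exact: setUS.
by rewrite setU1D1 //; apply: contra aA => /(subsetP SA).
Qed.

(** * Kernels on sets of variables *)

(** Every factor tends to 1 at infinity, hence the constant 1; the other terms are the residues. The
    induction keeps [z] free: a new pole [q a] needs the hypothesis at [z] and again at [q a], for
    its own residue. *)
Lemma partial_fraction (K : fieldType) (I : finType) (A : {set I})
    (p q : I -> K) (z : K) :
    {in A &, injective q} -> {in A, forall i, z != q i} ->
  \prod_(j in A) ((z - p j) / (z - q j)) =
  1 + \sum_(i in A) (q i - p i) / (z - q i) *
        \prod_(j in A :\ i) ((q i - p j) / (q i - q j)).
Proof.
elim/set_ind_card: A z => [|a A aA IHA] z q_inj zq.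
  by rewrite !big_set0 addr0.
have qA : {in A &, injective q}.
  by move=> i j iA jA; apply: q_inj; rewrite !inE ?iA ?jA orbT.
have qa : {in A, forall i, q a != q i}.
  move=> i iA; apply: contraNneq aA => /q_inj ->; rewrite ?inE ?iA ?eqxx ?orbT //.
have za : z != q a by apply: zq; rewrite !inE eqxx.
have zA : {in A, forall i, z != q i} by move=> i iA; apply: zq; rewrite !inE iA orbT.
rewrite !big_setU1 //= IHA // setU1D1 // IHA //.
rewrite !mulrDr !mulr1 addrA addrA.
rewrite (_ : _ / _ = 1 + (q a - p a) / (z - q a)); last first.
  by field; rewrite subr_eq0.
rewrite -addrA; congr (_ + _).
rewrite !mulr_sumr -big_split /=; apply: eq_bigr => i iA.
have ai : a != i by apply: contraNneq aA => ->.
rewrite setU1D1_neq // big_setU1 /=; last by rewrite !inE (negPf aA) andbF.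
field.
rewrite !subr_eq0 zA // za /= (eq_sym (q i)) qa //.
Qed.

(** Pairs of a subset and a point inside it correspond to pairs of a subset and a point outside it.
    This moves a variable across a cut. *)
Lemma exchange_subset_elem (R : nmodType) (I : finType) (B : {set I})
    (G : {set I} -> I -> R) :
  \sum_(S : {set I} | S \subset B) \sum_(i in S) G (S :\ i) i =
  \sum_(S : {set I} | S \subset B) \sum_(i in B :\: S) G S i.
Proof.
rewrite (exchange_big_dep (mem B)) /=; last by move=> S i /subsetP; apply.
rewrite [RHS](exchange_big_dep (mem B)) /=; last by move=> S i _ /setDP[].
apply: eq_bigr => i iB.
rewrite (reindex_onto (fun S => i |: S) (fun S => S :\ i)) /=; last first.
  by move=> S /andP[_ iS]; rewrite setD1K.
apply: eq_big => [S|S /andP[_ /eqP ->] //].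
rewrite subUset sub1set iB !inE eqxx /= !andbT.
apply: andb_id2l => _; apply/eqP/idP => [<-|iS]; first by rewrite !inE eqxx.
by case/andP: iS => iS _; rewrite setU1D1.
Qed.

Section Kernels.
Variable K : fieldType.
Implicit Types (t : K).

Definition kr t (a b : K) := (a - t * b) / (a - b).
Definition fr t (a b : K) := (1 - t * a * b) / (1 - a * b).

Lemma frC t (a b : K) : fr t a b = fr t b a.
Proof. by rewrite /fr mulrAC (mulrC a). Qed.

Variables (N : nat) (t : K).
Implicit Types (x : 'I_N -> K) (A B S : {set 'I_N}) (a i j : 'I_N).

Definition krset x A B := \prod_(i in A) \prod_(j in B) kr t (x i) (x j).

Definition frset x A :=
  \prod_(i in A) \prod_(j in A | (i < j)%N) fr t (x i) (x j).

Definition cut x A S := krset x S (A :\: S) * frset x S.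

Definition hlF x (beta : nat -> K) A :=
  \sum_(S : {set 'I_N} | S \subset A) beta (#|A| - #|S|)%N * cut x A S.

Lemma krset_setU1l x a A B : a \notin A ->
  krset x (a |: A) B = (\prod_(j in B) kr t (x a) (x j)) * krset x A B.
Proof. by move=> aA; rewrite /krset big_setU1. Qed.

Lemma krset_setU1r x a A B : a \notin B ->
  krset x A (a |: B) = (\prod_(i in A) kr t (x i) (x a)) * krset x A B.
Proof.
move=> aB; rewrite /krset -big_split; apply: eq_bigr => i iA.
by rewrite big_setU1.
Qed.

Lemma frset_setU1 x a A : a \notin A ->
  frset x (a |: A) = (\prod_(j in A) fr t (x a) (x j)) * frset x A.
Proof.
move=> aA; rewrite /frset; under eq_bigr do rewrite big_mkcondr.
rewrite big_setU1 //= big_setU1 //= ltnn mul1r.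
under [X in _ * X]eq_bigr do rewrite big_setU1 //=.
rewrite big_split /= mulrA -big_split /=; congr (_ * _).
  apply: eq_bigr => j jA; have aj: a != j by apply: contraNneq aA => ->.
  by case: ltngtP => [||/val_inj/eqP]; rewrite ?mulr1 ?mul1r ?(negPf aj) // frC.
by apply: eq_bigr => i _; rewrite big_mkcondr.
Qed.

Lemma frset0 x : frset x set0 = 1. Proof. by rewrite /frset big_set0. Qed.

Lemma subset_notin a A S : a \notin A -> S \subset A -> a \notin S.
Proof. by move=> aA SA; apply: contra aA => /(subsetP SA). Qed.

Lemma cut_setU1l x a A S : a \notin A -> S \subset A ->
  cut x (a |: A) S = cut x A S * \prod_(j in S) kr t (x j) (x a).
Proof.
move=> aA SA; have aS := subset_notin aA SA.
rewrite /cut (_ : (a |: A) :\: S = a |: (A :\: S)); last first.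
  by apply/setP=> j; rewrite !inE; case: eqVneq => [->|]; rewrite ?(negPf aS).
by rewrite krset_setU1r ?inE ?(negPf aA) ?andbF //; ring.
Qed.

Lemma cut_setU1r x a A S : a \notin A -> S \subset A ->
  cut x (a |: A) (a |: S) =
  cut x A S * (\prod_(i in A :\: S) kr t (x a) (x i)
               * \prod_(j in S) fr t (x a) (x j)).
Proof.
move=> aA SA; have aS := subset_notin aA SA.
rewrite /cut (_ : (a |: A) :\: (a |: S) = A :\: S); last first.
  apply/setP=> j; rewrite !inE; case: eqVneq => [->|] //=.
  by rewrite (negPf aA) andbF.
by rewrite krset_setU1l // frset_setU1 //; ring.
Qed.

(** The subsets of [a |: A] come in pairs [S], [a |: S]. Leaving [a] outside enlarges the complement
    by one, hence the shifted index of [beta]. *)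
Lemma hlF_setU1 x beta a A : a \notin A ->
  hlF x beta (a |: A) =
  \sum_(S : {set 'I_N} | S \subset A) cut x A S *
    (beta (#|A| - #|S|)%N * (\prod_(i in A :\: S) kr t (x a) (x i)
                             * \prod_(j in S) fr t (x a) (x j))
     + beta (#|A| - #|S|).+1 * \prod_(j in S) kr t (x j) (x a)).
Proof.
move=> aA; rewrite /hlF big_subset_setU1 //; apply: eq_bigr => S SA.
have aS := subset_notin aA SA.
rewrite cut_setU1l // cut_setU1r // !cardsU1 aA aS /= subnDl add1n.
by rewrite subSn ?subset_leq_card //; ring.
Qed.

Lemma hlF_ext x y beta A : {in A, x =1 y} -> hlF x beta A = hlF y beta A.
Proof.
move=> xy; apply: eq_bigr => S /subsetP SA; congr (_ * (_ * _)).
  apply: eq_bigr => i iS; apply: eq_bigr => j /setDP[jA _].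
  by rewrite !xy // SA.
by apply: eq_bigr => i iS; apply: eq_bigr => j /andP[jS _]; rewrite !xy // SA.
Qed.

Lemma cardsDsub A S : S \subset A -> #|A :\: S| = (#|A| - #|S|)%N.
Proof. by move=> SA; rewrite cardsD (setIidPr SA). Qed.

(** Both sides are the cut of [B :\ i] at [S] times the same three products of factors at [i]. The
    cross-multiplied form avoids any nonvanishing condition. *)
Lemma cut_swap x B S i : S \subset B -> i \in B :\: S ->
  cut x B (i |: S) * \prod_(j in S) kr t (x j) (x i) =
  cut x B S * (\prod_(k in (B :\: S) :\ i) kr t (x i) (x k)
               * \prod_(j in S) fr t (x i) (x j)).
Proof.
move=> SB /setDP[iB iS]; have iBi : i \notin B :\ i by rewrite !inE eqxx.
have SBi : S \subset B :\ i by rewrite subsetD1 SB.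
rewrite -{1 2}(setD1K iB) cut_setU1r // cut_setU1l //.
rewrite (_ : (B :\ i) :\: S = (B :\: S) :\ i); first by ring.
by apply/setP=> j; rewrite !inE andbCA.
Qed.

(** Partial fractions with zeros [t * x i] and poles [x i], evaluated at 0, where the product is
    [t ^+ #|A|]. *)
Lemma sum_kr x A : t != 1 -> {in A, forall i, x i != 0} -> {in A &, injective x} ->
  \sum_(i in A) \prod_(j in A :\ i) kr t (x i) (x j) = (1 - t ^+ #|A|) / (1 - t).
Proof.
move=> t1 x0 xinj; have t1' : 1 - t != 0 by rewrite subr_eq0 eq_sym.
have := @partial_fraction _ _ A (fun i => t * x i) x 0 xinj.
have -> : \prod_(j in A) ((0 - t * x j) / (0 - x j)) = t ^+ #|A|.
  rewrite -prodr_const; apply: eq_bigr => j jA.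
  by field; rewrite oppr_eq0 x0.
move=> -> => [|i iA]; last by rewrite eq_sym x0.
apply: (mulIf t1'); rewrite divfK // opprD addrA subrr sub0r -sumrN mulr_suml.
apply: eq_bigr => i iA; rewrite mulrC; set P := (X in _ = - (_ * X)).
by rewrite -mulNr; congr (_ * _); field; rewrite oppr_eq0 x0.
Qed.

End Kernels.

(** * The expansion of F_beta along a variable *)

Section InversePair.
Variables (K : fieldType) (N : nat) (t u : K) (beta : nat -> K).
Hypotheses (t0 : t != 0) (t1 : t != 1).
Hypothesis beta_rec : forall r,
  beta r.+2 = - (1 + t ^+ r.+1) * beta r.+1 - u * t ^+ r * beta r.
Implicit Types (x : 'I_N -> K) (A B S : {set 'I_N}) (a b i j : 'I_N).

(** The last three conditions include [i = j]. They also say that the interpolation nodes x_j, 1/x_j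
    and 1/(t x_k) used for the expansion are distinct. *)
Definition generic x A :=
  [/\ {in A, forall i, x i != 0}, {in A &, injective x},
      {in A &, forall i j, 1 - x i * x j != 0},
      {in A &, forall i j, 1 - t * x i * x j != 0}
    & {in A &, forall i j, x i - t * x j != 0}].

Lemma generic_sub x A B : generic x A -> B \subset A -> generic x B.
Proof.
move=> [x0 xi x1 xt xq] /subsetP BA; split.
- by move=> i /BA/x0.
- by move=> i j /BA iA /BA jA; apply: xi.
- by move=> i j /BA iA /BA jA; apply: x1.
- by move=> i j /BA iA /BA jA; apply: xt.
- by move=> i j /BA iA /BA jA; apply: xq.
Qed.

Lemma generic_neq x A i j : generic x A -> i \in A -> j \in A -> i != j ->
  x i - x j != 0.
Proof.
by move=> [_ xi _ _ _] iA jA; apply: contraNneq => /eqP; rewrite subr_eq0 => /eqP/xi->.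
Qed.

(* Partial fractions in x_a + x_b: both factors depend on (x_a, x_b) only through
   this sum, since x_a x_b = 1/t. *)
Lemma prod_kr2 x B a b : generic x B -> x a != 0 -> t * x a * x b = 1 ->
    {in B, forall i, x i != x a} -> {in B, forall i, x i != x b} ->
  \prod_(j in B) (kr t (x j) (x a) * kr t (x j) (x b)) = t ^+ #|B| +
  \sum_(i in B) t ^+ #|B|.-1 * (kr t (x i) (x a) * kr t (x i) (x b) - t) *
     \prod_(j in B :\ i) (kr t (x j) (x i) / fr t (x i) (x j)).
Proof.
move=> gB xa0 tab Ba Bb; have [x0 xi x1 xt _] := gB.
have xb : x b = (t * x a)^-1 by rewrite -[RHS]mul1r -tab mulrC mulKf // mulf_neq0.
(* [q j] is the value of x_a + x_b when one of them is x_j, and [p j] the value when one of them is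
   x_j / t; the relation x_a x_b = 1/t fixes the other. *)
pose q j := x j + (t * x j)^-1; pose p j := x j / t + (x j)^-1.
pose z := x a + x b.
have zq j : j \in B -> z - q j = - (x j - x a) * (x j - x b) / x j.
  by move=> jB; rewrite /z /q xb; field; rewrite t0 xa0 x0.
have zq0 j : j \in B -> z - q j != 0.
  by move=> jB; rewrite zq // mulf_neq0 ?invr_eq0 ?x0 ?mulf_neq0 ?oppr_eq0 // subr_eq0 ?Ba ?Bb.
have zp j : j \in B -> z - p j = - t^-1 * (x j - t * x a) * (x j - t * x b) / x j.
  by move=> jB; rewrite /z /p xb; field; rewrite t0 xa0 x0.
have krE j : j \in B -> kr t (x j) (x a) * kr t (x j) (x b) = t * ((z - p j) / (z - q j)).
  move=> jB; rewrite zp // zq // /kr; field.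
  by rewrite x0 // t0 oppr_eq0 !subr_eq0 Ba ?Bb.
have qij i j : i \in B -> j \in B ->
    q i - q j = - (x i - x j) * (1 - t * x i * x j) / (t * x i * x j).
  by move=> iB jB; rewrite /q; field; rewrite t0 !x0.
have qp i j : i \in B -> j \in B ->
    q i - p j = (x j - t * x i) * (1 - x i * x j) / (t * x i * x j).
  by move=> iB jB; rewrite /q /p; field; rewrite t0 !x0.
under eq_bigr do rewrite krE //.
rewrite big_split /= prodr_const partial_fraction; first last.
- by move=> i iB; rewrite -subr_eq0 zq0.
- move=> i j iB jB /eqP; rewrite -subr_eq0 qij //; apply: contraTeq => ij.
  by rewrite !mulf_neq0 ?invr_eq0 ?mulf_neq0 ?oppr_eq0 ?x0 ?xt ?(generic_neq gB).
rewrite mulrDr mulr1; congr (_ + _); rewrite mulr_sumr; apply: eq_bigr => i iB.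
rewrite krE // [LHS]mulrA; congr (_ * _).
  rewrite (cardsD1 i) iB add1n exprS /=.
  set w := t ^+ _; have : z - q i != 0 by exact: zq0.
  by move: (z) (q i) (p i) => z' q' p' h; field.
apply: eq_bigr => j; rewrite !inE => /andP[ji jB].
have ij : i != j by rewrite eq_sym.
rewrite qp // qij // /kr /fr; field.
have := (generic_neq gB iB jB ij, generic_neq gB jB iB ji, x1 i j iB jB, xt i j iB jB).
by move=> [[[h1 h2] h3] h4]; rewrite ?t0 ?x0 ?oppr_eq0 ?h1 ?h2 ?h3 ?h4.
Qed.

(** After c = 1/(t d) is inserted, both factors are quotients of d - e and t d - e, in opposite
    order, up to the factor t. *)
Lemma fr_kr_inv (c d e : K) : t * c * d = 1 -> e != d -> 1 - c * e != 0 ->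
  fr t c e * kr t e d = t.
Proof.
move=> tcd ed ce; have d0 : d != 0.
  by apply/eqP => d0; move: tcd; rewrite d0 mulr0 => /esym/eqP; rewrite oner_eq0.
have h : t * d - e != 0.
  rewrite (_ : _ - e = t * d * (1 - c * e)) ?mulf_neq0 //.
  by rewrite mulrBr mulr1; congr (_ - _); rewrite -[LHS]mul1r -tcd; ring.
move: h; have -> : c = (t * d)^-1.
  by apply: (mulIf (mulf_neq0 t0 d0)); rewrite mulVf ?mulf_neq0 // -tcd; ring.
by rewrite /kr /fr => h; field; rewrite subr_eq0 ed d0 t0.
Qed.

(** For fixed [S] in [B], with r = |B| - |S|, the term with both [a] and [b] inside vanishes because
    [fr t (x a) (x b) = 0]. The leading parts of the other three add up to t^|S| ((1 + t^(r+1))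
    beta_(r+1) + beta_(r+2)), which the recursion turns into -u t^|B| beta_r. What remains is a sum
    over [i] in [S] and one over [i] outside [S]; they cancel once [i] is moved across the cut. *)
Lemma hlF_inverse_pair x B a b : a != b -> a \notin B -> b \notin B -> generic x B ->
    x a != 0 -> x b != 0 -> x a != x b -> t * x a * x b = 1 ->
    {in B, forall i, x i != x a} -> {in B, forall i, x i != x b} ->
    {in B, forall i, 1 - x a * x i != 0} -> {in B, forall i, 1 - x b * x i != 0} ->
  hlF t x beta (a |: (b |: B)) = - u * t ^+ #|B| * hlF t x beta B.
Proof.
move=> ab aB bB gB xa0 xb0 xab tab Ba Bb aB1 bB1; have [x0 xi x1 xt _] := gB.
have abB : a \notin b |: B by rewrite !inE negb_or ab.
pose v i := kr t (x i) (x a) * kr t (x i) (x b).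
have frab : fr t (x a) (x b) = 0 by rewrite /fr tab subrr mul0r.
rewrite hlF_setU1 // big_subset_setU1 //.
under eq_bigr => S SB.
  have aS := subset_notin aB SB; have bS := subset_notin bB SB.
  rewrite (_ : (b |: B) :\: S = b |: (B :\: S)); last first.
    by apply/setP=> j; rewrite !inE; case: eqVneq => [->|]; rewrite ?(negPf bS).
  rewrite (_ : (b |: B) :\: (b |: S) = B :\: S); last first.
    apply/setP=> j; rewrite !inE; case: eqVneq => [->|] //=.
    by rewrite (negPf bB) andbF.
  rewrite cut_setU1l // cut_setU1r // !cardsU1 bB bS subnDl add1n.
  rewrite subSn ?subset_leq_card // !big_setU1 //= ?inE ?(negPf bB) ?andbF // frab.
  over.
rewrite /=.
have termE S : S \subset B ->
    cut t x B S * \prod_(j in S) kr t (x j) (x b) *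
      (beta (#|B| - #|S|).+1 *
       (kr t (x a) (x b) * \prod_(i in B :\: S) kr t (x a) (x i) *
        \prod_(j in S) fr t (x a) (x j)) +
       beta (#|B| - #|S|).+2 * \prod_(j in S) kr t (x j) (x a)) +
      cut t x B S *
      (\prod_(i in B :\: S) kr t (x b) (x i) *
       \prod_(j in S) fr t (x b) (x j)) *
      (beta (#|B| - #|S|)%N *
       (\prod_(i in B :\: S) kr t (x a) (x i) *
        (0 * \prod_(i in S) fr t (x a) (x i))) +
       beta (#|B| - #|S|).+1 *
       (kr t (x b) (x a) * \prod_(i in S) kr t (x i) (x a))) =
    - u * t ^+ #|B| * (beta (#|B| - #|S|)%N * cut t x B S)
    + (\sum_(i in S) cut t x B S * beta (#|B| - #|S|).+2 * (t ^+ #|S|.-1 * (v i - t) *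
         \prod_(j in S :\ i) (kr t (x j) (x i) / fr t (x i) (x j)))
    - \sum_(i in B :\: S) cut t x B S * beta (#|B| - #|S|).+1 * t ^+ #|S| * (v i - t) *
         \prod_(k in (B :\: S) :\ i) kr t (x i) (x k)).
  move=> SB; have gS := generic_sub gB SB.
  have inB i : i \in B :\: S -> i \in B by case/setDP.
  have inS i : i \in S -> i \in B by exact: (subsetP SB).
  have kf1 : \prod_(j in S) fr t (x a) (x j) * \prod_(j in S) kr t (x j) (x b) = t ^+ #|S|.
    rewrite -big_split -prodr_const; apply: eq_bigr => j /inS jB /=.
    by rewrite fr_kr_inv ?Bb ?aB1.
  have kf2 : \prod_(j in S) fr t (x b) (x j) * \prod_(j in S) kr t (x j) (x a) = t ^+ #|S|.
    rewrite -big_split -prodr_const; apply: eq_bigr => j /inS jB /=.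
    by rewrite fr_kr_inv ?Ba ?bB1 // mulrAC.
  have V : \prod_(j in S) kr t (x j) (x a) * \prod_(j in S) kr t (x j) (x b) =
     t ^+ #|S| + \sum_(i in S) t ^+ #|S|.-1 * (v i - t) *
         \prod_(j in S :\ i) (kr t (x j) (x i) / fr t (x i) (x j)).
    rewrite -big_split; apply: prod_kr2 => // i /inS; [exact: Ba|exact: Bb].
  (* With [m] = (1 - t^m)/(1 - t), [sum_kr] over [a], [b] and [B :\: S] gives [r+2], and its terms
     at [i] in [B :\: S] carry the factor [v i]. Writing [v i] as [(v i - t) + t] leaves [r+2] - t
     [r] = 1 + t^(r+1). *)
  have W : kr t (x a) (x b) * \prod_(i in B :\: S) kr t (x a) (x i)
         + kr t (x b) (x a) * \prod_(i in B :\: S) kr t (x b) (x i) =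
     1 + t ^+ (#|B| - #|S|).+1 - \sum_(i in B :\: S) (v i - t) *
         \prod_(k in (B :\: S) :\ i) kr t (x i) (x k).
    have aI : a \notin B :\: S by rewrite !inE (negPf aB) andbF.
    have bI : b \notin B :\: S by rewrite !inE (negPf bB) andbF.
    have abI : a \notin b |: (B :\: S) by rewrite !inE (negPf ab) (negPf aB) andbF.
    have xI0 : {in B :\: S, forall i, x i != 0} by move=> i /inB/x0.
    have xIi : {in B :\: S &, injective x}.
      by move=> i j /inB iB /inB jB; apply: xi.
    have := @sum_kr _ _ t x (a |: (b |: (B :\: S))) t1.
    have -> : \sum_(i in B :\: S) (v i - t) * \prod_(k in (B :\: S) :\ i) kr t (x i) (x k)
      = \sum_(i in B :\: S) v i * \prod_(k in (B :\: S) :\ i) kr t (x i) (x k)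
       - t * ((1 - t ^+ (#|B| - #|S|)) / (1 - t)).
      rewrite -cardsDsub // -(sum_kr t1 xI0 xIi) mulr_sumr -sumrB.
      by apply: eq_bigr => i _; rewrite mulrBl.
    rewrite !big_setU1 //= setU1D1 // big_setU1 //=.
    rewrite setU1D1_neq // setU1D1 // big_setU1 //=.
    rewrite !cardsU1 abI bI cardsDsub // !add1n => Hs.
    set sv := \sum_(i in _) _.
    have e1 : \sum_(i in B :\: S) \prod_(j in (a |: (b |: (B :\: S))) :\ i) kr t (x i) (x j) = sv.
      apply: eq_bigr => i iI.
      have ai : a != i by apply: contraNneq aI => ->.
      have bi : b != i by apply: contraNneq bI => ->.
      rewrite setU1D1_neq // big_setU1 /=; last first.
        by rewrite !inE (negPf ab) (negPf aB) !andbF.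
      rewrite setU1D1_neq // big_setU1 /=; last first.
        by rewrite !inE (negPf bB) !andbF.
      by rewrite mulrA.
    rewrite e1 in Hs; apply: (addIr sv); rewrite [RHS]addrAC.
    rewrite -[LHS]addrA Hs; last 2 first.
    - by move=> i; rewrite !inE => /or3P[/eqP->|/eqP->|/andP[_ /x0]].
    - move=> i j; rewrite !in_setU1.
      case/predU1P=> [->|/predU1P[->|/inB iB]] /predU1P[->|/predU1P[->|/inB jB]] // e.
      + by rewrite e eqxx in xab.
      + by have := Ba _ jB; rewrite e eqxx.
      + by rewrite e eqxx in xab.
      + by have := Bb _ jB; rewrite e eqxx.
      + by have := Ba _ iB; rewrite e eqxx.
      + by have := Bb _ iB; rewrite e eqxx.
      exact: xi.
    rewrite !exprS; field.
    by rewrite subr_eq0 eq_sym.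
  under [X in _ - X]eq_bigr do rewrite -mulrA.
  rewrite -!mulr_sumr -[X in t ^+ X](subnK (subset_leq_card SB)) exprD.
  move: V W kf1 kf2 (beta_rec (#|B| - #|S|)).
  set c := cut _ _ _ _; set r := (#|B| - #|S|)%N.
  set b0 := beta r; set b1 := beta r.+1; set b2 := beta r.+2.
  set sv := \sum_(i in S) _; set sw := \sum_(i in _ :\: _) _.
  set Pa := \prod_(j in S) kr t (x j) (x a); set Pb := \prod_(j in S) kr t (x j) (x b).
  set Fa := \prod_(j in S) fr t _ _; set Fb := \prod_(j in S) fr t (x b) _.
  set Ia := \prod_(i in _) kr t (x a) _; set Ib := \prod_(i in _) kr t (x b) _.
  set ts := t ^+ #|S|; set tr := t ^+ r; set tr1 := t ^+ r.+1.
  move=> V W kf1 kf2 b2E.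
  transitivity (c * (b1 * (kr t (x a) (x b) * Ia * (Fa * Pb)
    + kr t (x b) (x a) * Ib * (Fb * Pa)) + b2 * (Pa * Pb))); first by ring.
  by rewrite kf1 kf2 -mulrDl V W b2E; ring.
under eq_bigr do rewrite termE //.
rewrite big_split /= -mulr_sumr -[RHS]addr0; congr (_ + _).
rewrite sumrB; apply/eqP; rewrite subr_eq0; apply/eqP.
(* The summand of the first sum at the subset [i |: S], expressed through [S]: the larger subset
   lowers the index of [beta] to that of the second sum. *)
pose G S i := cut t x B (i |: S) * beta (#|B| - #|i |: S|).+2 *
  (t ^+ #|S| * (v i - t) * \prod_(j in S) (kr t (x j) (x i) / fr t (x i) (x j))).
transitivity (\sum_(S : {set 'I_N} | S \subset B) \sum_(i in S) G (S :\ i) i).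
  apply: eq_bigr => S SB; apply: eq_bigr => i iS.
  by rewrite /G setD1K // (cardsD1 i S) iS.
rewrite exchange_subset_elem; apply: eq_bigr => S SB; apply: eq_bigr => i iBS.
have [iB iS] := setDP iBS.
have ltSB : (#|S| < #|B|)%N.
  by rewrite proper_card // properE SB; apply/subsetPn; exists i.
rewrite /G cardsU1 iS add1n subnSK //.
set b1 := beta _; rewrite prodf_div.
have fr0 : \prod_(j in S) fr t (x i) (x j) != 0.
  apply/prodf_neq0 => j jS; have jB := subsetP SB _ jS.
  by rewrite mulf_neq0 ?invr_eq0 ?x1 ?xt.
have := cut_swap t x SB iBS; set Q := \prod_(k in _ :\ i) _.
move: fr0; set P := \prod_(j in S) fr _ _ _; set P' := \prod_(j in S) _.
move=> P0 e; apply: (mulIf P0).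
transitivity (cut t x B (i |: S) * P' * (b1 * t ^+ #|S| * (v i - t))); first by field.
by rewrite e; ring.
Qed.

End InversePair.

(** * Polynomial functions of bounded degree *)

Section PolyFun.
Variable K : fieldType.
Implicit Types (d e : nat) (f g : K -> K).

Definition polyfun d f := exists2 p : {poly K}, (size p <= d.+1)%N & forall z, f z = p.[z].

Lemma polyfun_lin (a b : K) f : (forall z, f z = a + b * z) -> polyfun 1 f.
Proof.
move=> fE; exists (a%:P + b *: 'X) => [|z]; last by rewrite fE !hornerE.
rewrite (leq_trans (size_polyD _ _)) // geq_max (leq_trans (size_polyC_leq1 _)) //.
by rewrite (leq_trans (size_scale_leq _ _)) // size_polyX.
Qed.

Lemma polyfunW d e f : (d <= e)%N -> polyfun d f -> polyfun e f.
Proof. by move=> de [p sp fp]; exists p => //; apply: leq_trans sp _. Qed.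

Lemma polyfunD d f g : polyfun d f -> polyfun d g -> polyfun d (fun z => f z + g z).
Proof.
move=> [p sp fp] [q sq gq]; exists (p + q) => [|z]; last by rewrite hornerD fp gq.
by rewrite (leq_trans (size_polyD _ _)) // geq_max sp.
Qed.

Lemma polyfunZ d f (c : K) : polyfun d f -> polyfun d (fun z => c * f z).
Proof.
move=> [p sp fp]; exists (c *: p) => [|z]; last by rewrite hornerZ fp.
by rewrite (leq_trans (size_scale_leq _ _)).
Qed.

Lemma polyfunM d e f g : polyfun d f -> polyfun e g -> polyfun (d + e) (fun z => f z * g z).
Proof.
move=> [p sp fp] [q sq gq]; exists (p * q) => [|z]; last by rewrite hornerM fp gq.
rewrite (leq_trans (size_polyMleq _ _)) //; have := leq_add sp sq.
by rewrite addnS addSn; case: (_ + _)%N.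
Qed.

Lemma eq_polyfun d f g : f =1 g -> polyfun d f -> polyfun d g.
Proof. by move=> fg [p sp fp]; exists p => // z; rewrite -fg. Qed.

Lemma polyfun_sum d (I : finType) (P : pred I) (F : I -> K -> K) :
  (forall i, P i -> polyfun d (F i)) -> polyfun d (fun z => \sum_(i | P i) F i z).
Proof.
move=> pF; elim: (index_enum I) => [|i r IHr].
  by exists 0 => [|z]; rewrite ?size_poly0 // big_nil horner0.
have [Pi|nPi] := boolP (P i).
  by apply: eq_polyfun (polyfunD (pF i Pi) IHr) => z; rewrite big_cons Pi.
by apply: eq_polyfun IHr => z; rewrite big_cons (negPf nPi).
Qed.

Lemma polyfun_prod d (I : finType) (A : {set I}) (F : I -> K -> K) :
  (forall i, i \in A -> polyfun d (F i)) ->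
  polyfun (d * #|A|) (fun z => \prod_(i in A) F i z).
Proof.
move=> pF; rewrite -sum1_card big_distrr /=.
elim: (index_enum I) => [|i r IHr].
  by exists 1 => [|z]; rewrite ?size_poly1 // big_nil hornerC.
have [Ai|nAi] := boolP (i \in A).
  apply: eq_polyfun (polyfunW _ (polyfunM (pF i Ai) IHr)) => [z|].
    by rewrite big_cons Ai.
  by rewrite big_cons Ai muln1.
apply: eq_polyfun (polyfunW _ IHr) => [z|]; rewrite big_cons (negPf nAi) //.
Qed.

Lemma polyfun_eq d f g (s : seq K) : polyfun d f -> polyfun d g ->
  uniq s -> (d < size s)%N -> {in s, f =1 g} -> f =1 g.
Proof.
move=> [p sp fp] [q sq gq] us ds fg z; rewrite fp gq.
suff -> : p = q by [].
apply/eqP; rewrite -subr_eq0; apply: contraTT ds => nz; rewrite -leqNgt.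
have : all (root (p - q)) s.
  by apply/allP => y ys; rewrite /root hornerD hornerN -fp -gq fg // subrr.
move=> /max_poly_roots/(_ us) H; rewrite -ltnS (leq_trans (H nz)) //.
by rewrite (leq_trans (size_polyD _ _)) // geq_max sp size_polyN.
Qed.

End PolyFun.

(** Pairs [j < l] are matched with their transposes, so 2 need not be cancelled. *)
Lemma antisym_sum (V : zmodType) (N : nat) (B : {set 'I_N}) (phi : 'I_N -> 'I_N -> V) :
    {in B &, forall j l, j != l -> phi j l = - phi l j} ->
  \sum_(j in B) \sum_(l in B :\ j) phi j l = 0.
Proof.
move=> anti.
transitivity (\sum_(j in B) \sum_(l in B | (j < l)%N) phi j l
            + \sum_(j in B) \sum_(l in B | (l < j)%N) phi j l).
  rewrite -big_split; apply: eq_bigr => j jB /=.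
  rewrite (bigID (fun l : 'I_N => (j < l)%N)) /=; congr (_ + _); apply: eq_bigl => l;
    by rewrite !inE -val_eqE /=; case: ltngtP; rewrite ?andbT ?andbF.
rewrite [X in _ + X](exchange_big_dep (mem B)) /=; last by move=> ? ? _ /andP[].
rewrite -big_split big1 // => j jB /=.
rewrite [X in _ + X](eq_bigl (fun l => (l \in B) && (j < l)%N)); last first.
  by move=> l; rewrite jB.
rewrite -big_split big1 //= => l /andP[lB jl].
by rewrite anti ?addNr // -val_eqE neq_ltn jl.
Qed.

(** * Interpolation of both sides of the expansion *)

Section Expansion.
Variables (K : fieldType) (N : nat) (t u : K) (beta : nat -> K).
Hypotheses (t0 : t != 0) (t1 : t != 1).
Hypothesis beta_rec : forall r,
  beta r.+2 = - (1 + t ^+ r.+1) * beta r.+1 - u * t ^+ r * beta r.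
Implicit Types (x : 'I_N -> K) (A B S : {set 'I_N}) (a b i j k : 'I_N) (z : K).

Notation generic := (@generic K N t).
Notation F := (hlF t).

(* The two sides of the expansion along x_a = z, times
   prod_(k in A) (z - x_k)(1 - x_k z). *)
Definition expand_lhs x A z := \sum_(S : {set 'I_N} | S \subset A) cut t x A S *
  (beta (#|A| - #|S|) *
      (\prod_(i in A :\: S) ((z - t * x i) * (1 - x i * z))
       * \prod_(j in S) ((1 - t * x j * z) * (z - x j)))
   + beta (#|A| - #|S|).+1 *
      (\prod_(j in S) ((t * z - x j) * (1 - x j * z))
       * \prod_(i in A :\: S) ((z - x i) * (1 - x i * z)))).

Definition expand_coef x A j := \prod_(k in A :\ j) ((1 - t * x k * x j) / (x j - x k)).

Definition expand_rhs x A z := \sum_(j in A) expand_coef x A j * F x beta (A :\ j) *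
  (((z - x j) * (1 - u + (u - t) * z * x j))
   * \prod_(k in A :\ j) ((1 - x k * z) * (1 - t * x k * z))).

Lemma polyfun_lhs x A : polyfun (2 * #|A|) (expand_lhs x A).
Proof.
have lin := @polyfun_lin K.
apply: polyfun_sum => S SA; apply: polyfunZ.
have cE : (2 * #|A| = 2 * #|A :\: S| + 2 * #|S|)%N.
  by rewrite -mulnDr cardsDsub // subnK // subset_leq_card.
apply: polyfunD; apply: polyfunZ; rewrite cE; last rewrite addnC.
  apply: polyfunM; apply: polyfun_prod => i _; apply: (@polyfunM K 1 1).
  - by apply: (lin (- (t * x i)) 1) => z; ring.
  - by apply: (lin 1 (- x i)) => z; ring.
  - by apply: (lin 1 (- (t * x i))) => z; ring.
  - by apply: (lin (- x i) 1) => z; ring.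
apply: polyfunM; apply: polyfun_prod => i _; apply: (@polyfunM K 1 1).
- by apply: (lin (- x i) t) => z; ring.
- by apply: (lin 1 (- x i)) => z; ring.
- by apply: (lin (- x i) 1) => z; ring.
- by apply: (lin 1 (- x i)) => z; ring.
Qed.

Lemma polyfun_rhs x A : polyfun (2 * #|A|) (expand_rhs x A).
Proof.
have lin := @polyfun_lin K.
apply: polyfun_sum => j jA; apply: polyfunZ.
rewrite (cardsD1 j) jA mulnDr; apply: (@polyfunM K (2 * 1)); last first.
  apply: polyfun_prod => i _; apply: (@polyfunM K 1 1).
    by apply: (lin 1 (- x i)) => z; ring.
  by apply: (lin 1 (- (t * x i))) => z; ring.
apply: (@polyfunM K 1 1).
  by apply: (lin (- x j) 1) => z; ring.
by apply: (lin (1 - u) ((u - t) * x j)) => z; ring.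
Qed.

Lemma generic_setU1_neq x k B j : k \notin B -> generic x (k |: B) -> j \in B ->
  x k - x j != 0.
Proof.
move=> kB gA jB; apply: (generic_neq gA); rewrite ?in_setU1 ?eqxx ?jB ?orbT //.
by apply: contraNneq kB => ->.
Qed.

Lemma setU1D_in k B S : k \notin B -> S \subset B ->
  (k |: B) :\: S = k |: (B :\: S).
Proof.
move=> kB SB; have kS := subset_notin kB SB.
by apply/setP=> j; rewrite !inE; case: eqVneq => [->|]; rewrite ?(negPf kS).
Qed.

Lemma setU1D_U1 k B S : k \notin B -> (k |: B) :\: (k |: S) = B :\: S.
Proof.
move=> kB; apply/setP=> j; rewrite !inE; case: eqVneq => [->|] //=.
by rewrite (negPf kB) andbF.
Qed.

(** The assignment [y] may give [a] a new value, so that the cleared expression in [x] can be read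
    as F at [z = 1/(t x_k)] as well as at [z = x_a]. *)
Lemma expand_lhs_hlF x y a A : a \notin A -> {in A, x =1 y} ->
    {in A, forall k, y a - x k != 0} -> {in A, forall k, 1 - x k * y a != 0} ->
  F y beta (a |: A) * \prod_(k in A) ((y a - x k) * (1 - x k * y a)) = expand_lhs x A (y a).
Proof.
move=> aA xy h1 h2; rewrite hlF_setU1 // mulr_suml; apply: eq_bigr => S SA.
have SinA j : j \in S -> j \in A by exact: (subsetP SA).
have DinA j : j \in A :\: S -> j \in A by case/setDP.
have -> : cut t y A S = cut t x A S.
  congr (_ * _).
    apply: eq_bigr => i /SinA iS; apply: eq_bigr => j /DinA jA.
    by rewrite !xy.
  apply: eq_bigr => i /SinA iS; apply: eq_bigr => j /andP[/SinA jS _].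
  by rewrite !xy.
rewrite -mulrA; congr (_ * _).
rewrite [\prod_(k in A) _](big_setID S) /= (setIidPr SA).
set GS := \prod_(j in S) ((y a - x j) * (1 - x j * y a)).
set GI := \prod_(j in A :\: S) ((y a - x j) * (1 - x j * y a)).
have <- : \prod_(i in A :\: S) kr t (y a) (y i) * GI =
    \prod_(i in A :\: S) ((y a - t * x i) * (1 - x i * y a)).
  rewrite -big_split; apply: eq_bigr => i /DinA iA /=.
  by rewrite /kr -(xy i) //; field; rewrite h1.
have <- : \prod_(j in S) fr t (y a) (y j) * GS =
    \prod_(j in S) ((1 - t * x j * y a) * (y a - x j)).
  rewrite -big_split; apply: eq_bigr => j /SinA jA /=.
  by rewrite /fr -(xy j) // (mulrC (y a) (x j)); field; rewrite h2.
have <- : \prod_(j in S) kr t (y j) (y a) * GS =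
    \prod_(j in S) ((t * y a - x j) * (1 - x j * y a)).
  rewrite -big_split; apply: eq_bigr => j /SinA jA /=.
  by rewrite /kr -(xy j) //; field; rewrite -oppr_eq0 opprB h1.
by ring.
Qed.

(** At [z = x_k] the terms of [S] and [k |: S] are opposite. *)
Lemma expand_lhs_vanish x k B : k \notin B -> generic x (k |: B) -> expand_lhs x (k |: B) (x k) = 0.
Proof.
move=> kB gA; rewrite /expand_lhs big_subset_setU1 //; apply: big1 => S SB.
have kS := subset_notin kB SB.
rewrite setU1D_in // setU1D_U1 // cut_setU1l // cut_setU1r //.
rewrite !cardsU1 kB kS subnDl add1n subSn ?subset_leq_card //.
rewrite !big_setU1 ?inE ?(negPf kB) ?andbF //= subrr !(mul0r, mulr0, addr0, add0r).
have [x0 _ _ _ _] := gA; have kA : k \in k |: B by rewrite !inE eqxx.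
have BA j : j \in B -> j \in k |: B by move=> jB; rewrite !inE jB orbT.
have xkj j : j \in B -> x k - x j != 0.
  exact: generic_setU1_neq.
have [_ _ x1 _ _] := gA.
have e1 : \prod_(j in S) kr t (x j) (x k) *
    \prod_(j in S) ((1 - t * x j * x k) * (x k - x j)) =
    \prod_(j in S) fr t (x k) (x j) *
    \prod_(i in S) ((t * x k - x i) * (1 - x i * x k)).
  rewrite -!big_split; apply: eq_bigr => j jS /=; have jB := subsetP SB _ jS.
  rewrite /kr /fr (mulrC (x k) (x j)); field.
  by rewrite (x1 _ _ (BA _ jB) kA) /= -oppr_eq0 opprB xkj.
have e2 : \prod_(i in B :\: S) ((x k - t * x i) * (1 - x i * x k)) =
    \prod_(i in B :\: S) kr t (x k) (x i) *
    \prod_(i in B :\: S) ((x k - x i) * (1 - x i * x k)).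
  rewrite -big_split; apply: eq_bigr => i /setDP[iB _] /=.
  by rewrite /kr; field; rewrite xkj.
rewrite e2; set Q1 := \prod_(i in B :\: S) kr _ _ _; set Q2 := \prod_(i in _ :\: _) _.
move: e1; set P1 := \prod_(j in S) _; set P2 := \prod_(j in S) _.
set P3 := \prod_(j in S) _; set P4 := \prod_(j in S) _ => e1.
transitivity (cut t x B S * beta (#|B| - #|S|).+1 * (1 - t) * x k * (1 - x k * x k)
  * Q1 * Q2 * (P1 * P2 - P3 * P4)); first by ring.
by rewrite e1 subrr mulr0.
Qed.

(** Since [1 - x k * z] is zero here, only the subsets that contain [k] survive, through the first
    of their two summands; this leaves a sum over subsets of [B]. *)
Lemma expand_lhs_inv x k B : k \notin B -> generic x (k |: B) ->
  expand_lhs x (k |: B) (x k)^-1 = (1 - t) * ((x k)^-1 - x k) * F x beta B *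
    \prod_(l in B) ((1 - t * x l * x k) * (x k - t * x l) / (x k * x k)).
Proof.
move=> kB gA; have [x0 _ x1 _ _] := gA; have kA : k \in k |: B by rewrite !inE eqxx.
have BA j : j \in B -> j \in k |: B by move=> jB; rewrite !inE jB orbT.
have xk0 := x0 _ kA.
have xkj j : j \in B -> x k - x j != 0.
  exact: generic_setU1_neq.
rewrite /expand_lhs big_subset_setU1 // /hlF mulr_sumr mulr_suml; apply: eq_bigr => S SB.
have kS := subset_notin kB SB.
rewrite setU1D_in // setU1D_U1 // cut_setU1l // cut_setU1r //.
rewrite !cardsU1 kB kS subnDl add1n subSn ?subset_leq_card //.
rewrite !big_setU1 ?inE ?(negPf kB) ?andbF //= mulfV // subrr !(mul0r, mulr0, addr0, add0r).
rewrite [\prod_(l in B) _](big_setID S) /= (setIidPr SB).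
have -> : \prod_(i in S) ((1 - t * x i * x k) * (x k - t * x i) / (x k * x k)) =
   \prod_(j in S) fr t (x k) (x j) * \prod_(j in S) ((1 - t * x j / x k) * ((x k)^-1 - x j)).
  rewrite -big_split; apply: eq_bigr => j jS /=; have jB := subsetP SB _ jS.
  by rewrite /fr; field; rewrite xk0 (x1 _ _ kA (BA _ jB)).
have -> : \prod_(i in B :\: S) ((1 - t * x i * x k) * (x k - t * x i) / (x k * x k)) =
   \prod_(i in B :\: S) kr t (x k) (x i) *
   \prod_(i in B :\: S) (((x k)^-1 - t * x i) * (1 - x i / x k)).
  rewrite -big_split; apply: eq_bigr => i /setDP[iB _] /=.
  by rewrite /kr; field; rewrite xk0 xkj.
rewrite mulfK //; ring.
Qed.

(** Every term with [j != k] contains the vanishing factor. This covers both nodes 1/x_k and 1/(t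
    x_k). *)
Lemma expand_rhs_pole x k B z : k \notin B -> (1 - x k * z) * (1 - t * x k * z) = 0 ->
  expand_rhs x (k |: B) z = expand_coef x (k |: B) k * F x beta B *
   (((z - x k) * (1 - u + (u - t) * z * x k))
   * \prod_(l in B) ((1 - x l * z) * (1 - t * x l * z))).
Proof.
move=> kB z0; rewrite /expand_rhs big_setU1 //= setU1D1 // [X in _ + X]big1 ?addr0 // => j jB.
rewrite [X in _ * (_ * X)](bigD1 k) ?inE ?eqxx ?andbT /=; last first.
  by apply: contraNneq kB => ->.
by rewrite z0 mul0r !mulr0.
Qed.

Lemma expand_rhs_inv x k B : k \notin B -> generic x (k |: B) ->
  expand_rhs x (k |: B) (x k)^-1 = (1 - t) * ((x k)^-1 - x k) * F x beta B *
    \prod_(l in B) ((1 - t * x l * x k) * (x k - t * x l) / (x k * x k)).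
Proof.
move=> kB gA; have [x0 _ _ _ _] := gA; have kA : k \in k |: B by rewrite !inE eqxx.
have BA j : j \in B -> j \in k |: B by move=> jB; rewrite !inE jB orbT.
have xk0 := x0 _ kA.
have xkj j : j \in B -> x k - x j != 0.
  exact: generic_setU1_neq.
rewrite expand_rhs_pole // ?mulfV ?subrr ?mul0r // /expand_coef setU1D1 // mulfVK //.
transitivity ((1 - t) * ((x k)^-1 - x k) * F x beta B *
  (\prod_(l in B) ((1 - t * x l * x k) / (x k - x l)) *
   \prod_(l in B) ((1 - x l / x k) * (1 - t * x l / x k)))); first by ring.
congr (_ * _); rewrite -big_split; apply: eq_bigr => l lB /=.
by field; rewrite xk0 xkj.
Qed.

(** The index [a] is lent the value 1/(t x_k), which makes [a] and [k] an inverse pair for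
    [hlF_inverse_pair]. *)
Lemma expand_tinv x a k B : k \notin B -> a \notin k |: B -> generic x (k |: B) ->
  expand_lhs x (k |: B) (t * x k)^-1 = expand_rhs x (k |: B) (t * x k)^-1.
Proof.
move=> kB aA gA; have [x0 _ x1 xt xq] := gA; have kA : k \in k |: B by rewrite !inE eqxx.
have BA j : j \in B -> j \in k |: B by move=> jB; rewrite !inE jB orbT.
have xk0 := x0 _ kA.
have xkj j : j \in B -> x k - x j != 0.
  exact: generic_setU1_neq.
have [ak aB] : a != k /\ a \notin B by move: aA; rewrite !inE negb_or => /andP[].
pose y i := if i == a then (t * x k)^-1 else x i.
have yA : {in k |: B, x =1 y}.
  by move=> i iA; rewrite /y; case: eqP => // ia; rewrite -ia iA in aA.
have yB : {in B, x =1 y} by move=> i /BA/yA.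
have ya : y a = (t * x k)^-1 by rewrite /y eqxx.
have yk : y k = x k by rewrite yA.
have h1 i : i \in k |: B -> y a - x i != 0.
  move=> iA; rewrite ya (_ : _ - _ = (1 - t * x k * x i) / (t * x k)).
    by rewrite mulf_neq0 ?invr_eq0 ?mulf_neq0 ?xt.
  by field; rewrite t0 xk0.
have h2 i : i \in k |: B -> 1 - x i * y a != 0.
  move=> iA; rewrite ya (_ : _ - _ = - (x i - t * x k) / (t * x k)).
    by rewrite mulf_neq0 ?invr_eq0 ?mulf_neq0 ?oppr_eq0 ?xq.
  by field; rewrite t0 xk0.
rewrite -ya -(expand_lhs_hlF aA yA) //.
have gB : generic y B.
  have [z0 zi z1 zt zq] := generic_sub gA (subsetUr _ _).
  split.
  - by move=> i iB; rewrite -yB ?z0.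
  - by move=> i j iB jB; rewrite -!yB //; apply: zi.
  - by move=> i j iB jB; rewrite -!yB //; apply: z1.
  - by move=> i j iB jB; rewrite -!yB //; apply: zt.
  - by move=> i j iB jB; rewrite -!yB //; apply: zq.
have ya0 : y a != 0 by rewrite ya invr_eq0 mulf_neq0.
have yk0 : y k != 0 by rewrite yk.
have yak : y a != y k by rewrite -subr_eq0 yk h1.
have tyy : t * y a * y k = 1 by rewrite ya yk; field; rewrite xk0 t0.
have Ba : {in B, forall i, y i != y a}.
  by move=> i iB; rewrite -yB // eq_sym -subr_eq0 h1 ?BA.
have Bk : {in B, forall i, y i != y k}.
  by move=> i iB; rewrite -yB // yk eq_sym -subr_eq0 xkj.
have Ba1 : {in B, forall i, 1 - y a * y i != 0}.
  by move=> i iB; rewrite -(yB i) // mulrC h2 ?BA.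
have Bk1 : {in B, forall i, 1 - y k * y i != 0}.
  by move=> i iB; rewrite -(yB i) // yk (x1 _ _ kA (BA _ iB)).
rewrite (hlF_inverse_pair t0 t1 beta_rec ak aB kB gB ya0 yk0 yak tyy Ba Bk Ba1 Bk1).
rewrite expand_rhs_pole //; last by rewrite ya mulfV ?subrr ?mulr0 ?mulf_neq0.
rewrite big_setU1 //= /expand_coef setU1D1 // -(hlF_ext _ _ yB) -prodr_const.
set P1 := \prod_(i in B) t; set P2 := \prod_(j in B) ((y a - _) * _).
set P3 := \prod_(j in B) _; set P4 := \prod_(j in B) _.
have PP : P1 * P2 = P3 * P4.
  rewrite -!big_split; apply: eq_bigr => l lB /=; rewrite ya.
  by field; rewrite t0 xk0 xkj.
transitivity (- u * F x beta B * ((y a - x k) * (1 - x k * y a)) * (P1 * P2)); first by ring.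
by rewrite PP ya; field; rewrite t0 xk0.
Qed.

(* Expanding each F(A - {j}) once more along x_k gives a double sum antisymmetric in
   its two indices. *)
Lemma expand_rhs_vanish x k B : k \notin B -> generic x (k |: B) ->
    {in B, forall j, F x beta (k |: (B :\ j)) *
      \prod_(l in B :\ j) ((x k - x l) * (1 - x l * x k)) = expand_rhs x (B :\ j) (x k)} ->
  expand_rhs x (k |: B) (x k) = 0.
Proof.
move=> kB gA IH; have [x0 _ x1 xt _] := gA; have kA : k \in k |: B by rewrite !inE eqxx.
have BA j : j \in B -> j \in k |: B by move=> jB; rewrite !inE jB orbT.
have xkj j : j \in B -> x k - x j != 0 by exact: generic_setU1_neq.
have xk1 j : j \in B -> 1 - x j * x k != 0.
  by move=> jB; rewrite (x1 _ _ (BA _ jB) kA).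
rewrite /expand_rhs big_setU1 //= subrr !(mul0r, mulr0) add0r.
pose q j := (1 - x j * x k) * (1 - t * x j * x k).
pose n j := (x k - x j) * (1 - x j * x k).
pose h j := (x k - x j) * (1 - u + (u - t) * x k * x j).
have n0 j : j \in B -> n j != 0 by move=> jB; rewrite mulf_neq0 ?xkj ?xk1.
pose phi j l := expand_coef x B j * expand_coef x (B :\ j) l * h j * h l *
  F x beta (B :\ j :\ l) * \prod_(m in B :\ j :\ l) q m.
transitivity (- q k * \prod_(m in B) (q m / n m)
   * \sum_(j in B) \sum_(l in B :\ j) phi j l).
  rewrite mulr_sumr; apply: eq_bigr => j jB.
  have kj : k != j by apply: contraNneq kB => ->.
  have kBj : k \notin B :\ j by rewrite !inE (negPf kB) andbF.
  rewrite setU1D1_neq // big_setU1 //= -/(q k) -/(h j).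
  have nj0 : \prod_(l in B :\ j) n l != 0.
    by apply/prodf_neq0 => l /setD1P[_ /n0].
  apply: (mulIf nj0).
  transitivity (expand_coef x (k |: B) j * (F x beta (k |: (B :\ j)) * \prod_(l in B :\ j) n l)
    * (h j * (q k * \prod_(m in B :\ j) q m))); first by rewrite /q; ring.
  rewrite IH // /expand_rhs.
  rewrite [\prod_(m in B) (q m / n m)](big_setD1 j) //= prodf_div.
  have -> : expand_coef x (k |: B) j = - (q j / n j) * expand_coef x B j.
    rewrite /expand_coef setU1D1_neq // big_setU1 //=; congr (_ * _).
    rewrite /q /n; field; rewrite xk1 // xkj //= -oppr_eq0 opprB xkj //.
  rewrite /phi; set S1 := \sum_(l in _) _; set S2 := \sum_(l in _) _.
  have -> : S2 = expand_coef x B j * h j * S1.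
    rewrite /S1 /S2 mulr_sumr; apply: eq_bigr => l _; rewrite /q /h; ring.
  by field; rewrite nj0 n0.
rewrite antisym_sum ?mulr0 // => j l jB lB jl.
have xjl : x j - x l != 0.
  by apply: (generic_neq gA) => //; exact: BA.
rewrite /phi !setDDl (setUC [set j]).
(* With this factor split off, the product of the two coefficients in [phi] is symmetric except for
   a single 1/(x_j - x_l). *)
have coefE i m : i \in B -> m \in B -> i != m ->
    expand_coef x B i = (1 - t * x m * x i) / (x i - x m) * expand_coef x (B :\ m) i.
  move=> iB mB im; rewrite /expand_coef (big_setD1 m) /=; last by rewrite !inE mB eq_sym im.
  by congr (_ * _); apply: eq_bigl => z; rewrite !inE andbCA.
rewrite (coefE j l) // (coefE l j) 1?eq_sym //.
by field; rewrite xjl -oppr_eq0 opprB xjl.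
Qed.

Lemma hlF_expand x a A : odd #|A| -> a \notin A -> generic x (a |: A) ->
  F x beta (a |: A) * \prod_(k in A) ((x a - x k) * (1 - x k * x a)) = expand_rhs x A (x a).
Proof.
have [n] := ubnP #|A|; elim: n A a => // n IHn A a ltAn oddA aA gaA.
have [x0 xi x1 xt xq] := gaA.
have sA : A \subset a |: A by exact: subsetUr.
have AaA j : j \in A -> j \in a |: A by apply: (subsetP sA).
have aaA : a \in a |: A by rewrite !inE eqxx.
have gA := generic_sub gaA sA.
rewrite (@expand_lhs_hlF x x a A) //; last 2 first.
- by move=> k kA; apply: generic_setU1_neq gaA kA.
- by move=> k kA; rewrite (x1 _ _ (AaA _ kA) aaA).
have [k kA] : exists k, k \in A.
  by apply/set0Pn; apply: contraTneq oddA => ->; rewrite cards0.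
(* Degree 2|A| requires 2|A| + 1 nodes: all x_j and 1/x_j, and one more of the form 1/(t x_k). Such
   a [k] exists because [#|A|] is odd. The induction hypothesis, for sets with two elements fewer,
   is used only at the nodes x_j. *)
pose s := (t * x k)^-1 :: [seq x j | j <- enum A] ++ [seq (x j)^-1 | j <- enum A].
apply: (polyfun_eq (polyfun_lhs x A) (polyfun_rhs x A) (s := s)).
- rewrite /s cons_uniq mem_cat negb_or cat_uniq.
  rewrite !map_inj_in_uniq ?enum_uniq /=; last 2 first.
  + by move=> i j; rewrite !mem_enum => /AaA iA /AaA jA /invr_inj/xi->.
  + by move=> i j; rewrite !mem_enum => /AaA iA /AaA jA /xi->.
  rewrite andbT -andbA; apply/and3P; split.
  + apply/mapP => -[j]; rewrite mem_enum => jA e.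
    have := xt _ _ (AaA _ kA) (AaA _ jA); rewrite -e mulfV ?subrr ?eqxx //.
    by rewrite mulf_neq0 ?t0 ?x0 ?AaA.
  + apply/mapP => -[j]; rewrite mem_enum => jA /invr_inj e.
    by have := xq _ _ (AaA _ jA) (AaA _ kA); rewrite e subrr eqxx.
  apply/hasPn => _ /mapP[j + ->]; rewrite mem_enum => jA.
  apply/negP => /mapP[i]; rewrite mem_enum => iA e.
  have := x1 _ _ (AaA _ iA) (AaA _ jA); rewrite -e mulVf ?subrr ?eqxx //.
  by rewrite x0 ?AaA.
- by rewrite /= size_cat !size_map -cardE mul2n addnn.
move=> z; rewrite inE mem_cat => /or3P[/eqP->|/mapP[j]|/mapP[j]].
- rewrite -(setD1K kA) (@expand_tinv x a) ?setD1K //; first by rewrite !inE eqxx.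
- rewrite mem_enum => jA ->; have jAj : j \notin A :\ j by rewrite !inE eqxx.
  rewrite -(setD1K jA) expand_lhs_vanish ?expand_rhs_vanish ?setD1K // => i iA.
  have [ij iA'] := setD1P iA.
  apply: IHn.
  + move: ltAn; rewrite (cardsD1 j) jA (cardsD1 i (A :\ j)) iA !add1n ltnS.
    by apply: leq_trans.
  + by move: oddA; rewrite (cardsD1 j) jA (cardsD1 i (A :\ j)) iA /= !negbK.
  + by rewrite !inE eqxx andbF.
  apply: generic_sub gA _; rewrite subUset sub1set jA.
  by apply: subset_trans (subsetDl _ _) (subsetDl _ _).
rewrite mem_enum => jA ->; have jAj : j \notin A :\ j by rewrite !inE eqxx.
by rewrite -(setD1K jA) expand_lhs_inv ?expand_rhs_inv ?setD1K.
Qed.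

End Expansion.

(** * The Pfaffian *)

(** Permutations are sorted by the image [j] of 0; the rest is a permutation of the other points,
    read through [lift]. *)
Lemma sum_perm_lift (V : nmodType) (n : nat) (P : pred 'S_n.+1) (H : 'S_n.+1 -> V) :
  \sum_(w | P w) H w =
  \sum_(j < n.+1) \sum_(s : 'S_n | P (lift_perm ord0 j s)) H (lift_perm ord0 j s).
Proof.
rewrite (partition_big (fun w : 'S_n.+1 => w ord0) predT) //=.
apply: eq_bigr => j _.
(* The default value is never reached, as [w] is injective. *)
pose del (w : 'S_n.+1) (k : 'I_n) : 'I_n := odflt k (unlift (w ord0) (w (lift ord0 k))).
have delP (w : 'S_n.+1) (k : 'I_n) : lift (w ord0) (del w k) = w (lift ord0 k).
  rewrite /del; have : w ord0 != w (lift ord0 k).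
    by rewrite (inj_eq perm_inj) neq_lift.
  by case/unlift_some=> i -> ->.
have del_inj w : injective (del w).
  move=> k l e; apply: (@lift_inj _ ord0); apply: (@perm_inj _ w).
  by rewrite -!delP e.
pose delp w := perm (del_inj w).
rewrite (reindex (lift_perm ord0 j)) /=.
  by apply: eq_bigl => s; rewrite lift_perm_id eqxx andbT.
exists delp => [s _|w /andP[_ /eqP wj]].
  apply/permP => k; rewrite permE; apply: (@lift_inj _ j).
  by have := delP (lift_perm ord0 j s) k; rewrite lift_perm_id lift_perm_lift.
apply/permP => k; case: (unliftP ord0 k) => [k'|] ->.
  by rewrite lift_perm_lift permE -wj delP.
by rewrite lift_perm_id.
Qed.

Section PfaffianExpansion.
Variable R : comNzRingType.

Definition matching_perm (M : nat) (s : 'S_M) :=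
  [forall k : 'I_M, ~~ odd k ==> (s k < s (ordS k))%N] &&
  [forall k : 'I_M, forall l : 'I_M,
     [&& ~~ odd k, ~~ odd l & (k < l)%N] ==> (s k < s l)%N].

(** [pfaffian] with its size freed from the form [2 * n], so that two indices can be removed at a
    time. *)
Definition pf (M : nat) (A : 'I_M -> 'I_M -> R) : R :=
  \sum_(s : 'S_M | matching_perm s)
    (-1) ^+ s * \prod_(k < M | ~~ odd k) A (s k) (s (ordS k)).

Lemma eq_pf M (A B : 'I_M -> 'I_M -> R) : A =2 B -> pf A = pf B.
Proof.
by move=> AB; apply: eq_bigr => s _; congr (_ * _); apply: eq_bigr => k _; rewrite AB.
Qed.

(** Enumerates in increasing order the indices left when 0 is matched with [lift ord0 j]. *)
Definition lift2 M (j : 'I_M.+1) (k : 'I_M) : 'I_M.+2 := lift ord0 (lift j k).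

Lemma ordS_even M (k : 'I_M) : ~~ odd M -> ~~ odd k -> ordS k = k.+1 :> nat.
Proof.
move=> eM ek; rewrite /= modn_small // ltn_neqAle ltn_ord andbT.
by apply: contraNneq eM => <-; rewrite /= ek.
Qed.

Lemma ordS_even_lift M (k : 'I_M) : ~~ odd M -> ~~ odd k ->
  ordS (lift ord0 (lift ord0 k)) = lift ord0 (lift ord0 (ordS k)) :> 'I_M.+2.
Proof.
move=> eM ek; apply: ord_inj; rewrite !lift0 !ordS_even ?lift0 //= ?negbK //.
Qed.

Lemma lift2_ltn M (j : 'I_M.+1) (k l : 'I_M) : (lift2 j k < lift2 j l)%N = (k < l)%N.
Proof. rewrite /lift2 /= /bump /=; lia. Qed.

(** At an odd position the value 0 would exceed its partner on the left; at a positive even position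
    it would exceed [s ord0]. *)
Lemma matching_perm0 M (s : 'S_M.+2) : ~~ odd M -> matching_perm s -> s ord0 = ord0.
Proof.
move=> eM /andP[/forallP s1 /forallP s2].
have e2 : ~~ odd M.+2 by rewrite /= negbK.
pose k := (s^-1)%g ord0; have sk : s k = ord0 by rewrite permKV.
have [k0|k0] := eqVneq k ord0; first by rewrite -k0 sk.
have kpos : (0 < k)%N by rewrite lt0n; apply: contraNneq k0 => k0; apply/eqP/val_inj.
have [ok|ek] := boolP (odd k); last first.
  have /forallP/(_ k)/implyP := s2 ord0.
  by rewrite ek kpos sk /= => /(_ isT).
have lt_k : (k.-1 < M.+2)%N by apply: leq_ltn_trans (ltn_ord k); exact: leq_pred.
have ek1 : ~~ odd (Ordinal lt_k) by rewrite /=; lia.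
have /implyP/(_ ek1) := s1 (Ordinal lt_k).
rewrite (_ : ordS _ = k) ?sk //.
by apply: ord_inj; rewrite ordS_even //= prednK.
Qed.

Lemma matching_perm_lift M (j : 'I_M.+1) (s : 'S_M) : ~~ odd M ->
  matching_perm (lift_perm ord0 ord0 (lift_perm ord0 j s)) = matching_perm s.
Proof.
move=> eM; set w := lift_perm _ _ _.
have w0 : w ord0 = ord0 by rewrite lift_perm_id.
have w2 k : w (lift ord0 (lift ord0 k)) = lift2 j (s k).
  by rewrite !lift_perm_lift.
have wltn k l : (w (lift ord0 (lift ord0 k)) < w (lift ord0 (lift ord0 l)))%N = (s k < s l)%N.
  by rewrite !w2 lift2_ltn.
have ord2P (k : 'I_M.+2) : ~~ odd k -> k = ord0 \/ exists2 k' : 'I_M, k = lift ord0 (lift ord0 k') & ~~ odd k'.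
  case: (unliftP ord0 k) => [k1|] ->; last by left.
  case: (unliftP ord0 k1) => [k2|] -> //= ek; right; exists k2 => //.
  by rewrite /bump /= in ek; lia.
apply/andP/andP => -[/forallP s1 /forallP s2]; split; apply/forallP => k.
- apply/implyP => ek; have := s1 (lift ord0 (lift ord0 k)).
  by rewrite ordS_even_lift // wltn /= !negbK ek.
- apply/forallP => l; apply/implyP => /and3P[ek el kl].
  have /forallP/(_ (lift ord0 (lift ord0 l))) := s2 (lift ord0 (lift ord0 k)).
  by rewrite wltn /= !negbK ek el !ltnS /= => /implyP; apply; rewrite /bump /=; lia.
- apply/implyP => /ord2P[->|[k' -> ek]].
    rewrite w0 lt0n; apply: contraTneq isT => /= e.
    have /perm_inj : w (ordS ord0) = w ord0 by apply/val_inj; rewrite w0 /= e.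
    by move=> /(congr1 val) /=; rewrite modn_small.
  by rewrite ordS_even_lift // wltn; apply: (implyP (s1 k')).
apply/forallP => l; apply/implyP => /and3P[/ord2P[->|[k' -> ek]]].
  move=> _ l0; rewrite w0 lt0n; apply: contraTneq l0 => /= e.
  have /perm_inj -> : w l = w ord0 by apply/val_inj; rewrite w0 /= e.
  by [].
move=> /ord2P[->|[l' -> el]] kl //.
rewrite wltn; have /forallP/(_ l')/implyP := s2 k'; apply.
by rewrite ek el; move: kl; rewrite /= /bump /=; lia.
Qed.

(** By [matching_perm0] the permutation fixes 0, so it amounts to the partner of 0 and a matching of
    the remaining indices. *)
Lemma pf_expand M (A : 'I_M.+2 -> 'I_M.+2 -> R) : ~~ odd M ->
  pf A = \sum_(j < M.+1) (-1) ^+ j * A ord0 (lift ord0 j) *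
           pf (fun k l => A (lift2 j k) (lift2 j l)).
Proof.
move=> eM; rewrite /pf sum_perm_lift big_ord_recl /= [X in _ + X]big1 ?addr0; last first.
  move=> i _; apply: big_pred0 => s; apply: contraTF isT => /(matching_perm0 eM).
  by rewrite lift_perm_id => /(congr1 val).
rewrite sum_perm_lift; apply: eq_bigr => j _; rewrite mulr_sumr.
apply: eq_big => [s|s _]; first exact: matching_perm_lift.
rewrite !odd_lift_perm /= signr_addb signr_odd.
rewrite big_mkcond big_ord_recl big_ord_recl /= mul1r lift_perm_id.
rewrite (_ : ordS ord0 = lift ord0 ord0); last first.
  by apply/val_inj; rewrite /= modn_small.
rewrite lift_perm_lift lift_perm_id.
rewrite [in RHS]big_mkcond /=.
rewrite mulrACA; congr (_ * (_ * _)).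
apply: eq_bigr => i _; rewrite add0n negbK; case: ifP => // ei.
by rewrite ordS_even_lift ?ei // !lift_perm_lift.
Qed.

End PfaffianExpansion.

Lemma imset_lift0 (M : nat) (T : finType) (f : 'I_M.+1 -> T) :
  f @: setT = f ord0 |: (f \o lift ord0) @: setT.
Proof.
apply/setP => y; apply/imsetP/setU1P => [[k _ ->]|[->|/imsetP[k _ ->]]].
- case: (unliftP ord0 k) => [k'|] ->; [right|by left].
  by apply/imsetP; exists k'.
- by exists ord0.
by exists (lift ord0 k).
Qed.

Lemma imset_liftD1 (M : nat) (T : finType) (f : 'I_M.+1 -> T) (j : 'I_M.+1) :
  injective f -> (f @: setT) :\ f j = (f \o lift j) @: setT.
Proof.
move=> finj; apply/setP => y; rewrite !inE.
apply/andP/imsetP => [[yj /imsetP[k _ yk]]|[k _ ->]].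
  case: (unliftP j k) yk => [k'|] -> yk; first by exists k'.
  by rewrite yk eqxx in yj.
split; last by apply: imset_f.
by rewrite (inj_eq finj) eq_sym neq_lift.
Qed.

(** The sign counts the [j] pairs [(i, j)] with [i < j], whose denominators are reversed. *)
Lemma prod_pairs_lift (K : fieldType) (M : nat) (j : 'I_M.+1) (g h : 'I_M.+1 -> 'I_M.+1 -> K) :
    (forall i l, g i l = g l i) -> (forall i l, h i l = - h l i) ->
  \prod_(i < M.+1) \prod_(l < M.+1 | (i < l)%N) (g i l / h i l) =
  (-1) ^+ j * \prod_(k < M) (g j (lift j k) / h j (lift j k)) *
  \prod_(i < M) \prod_(l < M | (i < l)%N) (g (lift j i) (lift j l) / h (lift j i) (lift j l)).
Proof.
move=> gC hC.
have eq_cond n (i : 'I_n) (F : 'I_n -> K) :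
  \prod_(l < n | (i < l)%N) F l = \prod_(l < n) if (i < l)%N then F l else 1.
  by rewrite big_mkcond.
under eq_bigr do rewrite eq_cond.
rewrite (bigD1_ord j) //= (bigD1_ord j) //= ltnn mul1r.
under [X in _ * X]eq_bigr do rewrite (bigD1_ord j) //=.
rewrite big_split /= mulrA -big_split /=; congr (_ * _); last first.
  apply: eq_bigr => i _; rewrite eq_cond; apply: eq_bigr => l _.
  by rewrite (_ : (bump j i < bump j l)%N = (i < l)%N) // /bump; lia.
have -> : (-1) ^+ j = \prod_(k < M) (if (k < j)%N then -1 else 1) :> K.
  rewrite -big_mkcond (big_ord_narrow (ltn_ord j : (j <= M)%N)).
  by rewrite prodr_const card_ord.
rewrite -big_split /=; apply: eq_bigr => k _.
have [kj|kj] := ltnP k j.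
  rewrite /bump (leqNgt j k) kj add0n kj (ltnNge j k) (ltnW kj) /= mul1r.
  by rewrite gC hC invrN; ring.
by rewrite /bump kj add1n ltnS kj ltnNge leqW //= mulr1 mul1r.
Qed.

Section PfaffianSide.
Variables (K : fieldType) (N : nat) (t u : K) (beta : nat -> K) (x : 'I_N -> K).
Hypotheses (t0 : t != 0) (t1 : t != 1) (beta0 : beta 0 = 1).
Hypothesis beta_rec : forall r,
  beta r.+2 = - (1 + t ^+ r.+1) * beta r.+1 - u * t ^+ r * beta r.

Definition pf_entry (a b : K) :=
  ((a - b) * (1 - u + (u - t) * a * b)) / ((1 - a * b) * (1 - t * a * b)).

Lemma hlF0 : hlF t x beta set0 = 1.
Proof.
rewrite /hlF (big_pred1 set0) => [|S]; last by rewrite subset0.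
rewrite !cards0 beta0 mul1r /cut frset0 mulr1 /krset big_set0 //.
Qed.

(** Expansion of the Pfaffian along row 0 is compared with [hlF_expand] at [f ord0]; the sign
    [(-1) ^+ j] of the Pfaffian cancels against the one from the product over pairs. A general
    injection [f] lets the induction drop two variables. *)
Lemma pf_hlF (M : nat) (f : 'I_M -> 'I_N) : ~~ odd M -> injective f ->
    generic t x (f @: setT) ->
  \prod_(i < M) \prod_(j < M | (i < j)%N)
     ((1 - t * x (f i) * x (f j)) / (x (f i) - x (f j)))
   * pf (antisym_mx (fun i j => pf_entry (x (f i)) (x (f j)))) =
  hlF t x beta (f @: setT).
Proof.
elim/ltn_ind: M f => -[|[|M]] IHM f // eM finj gT.
  rewrite big_ord0 mul1r (_ : f @: setT = set0) ?hlF0; last first.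
    by apply/setP => y; rewrite inE; apply/imsetP => -[[]].
  rewrite /pf (big_pred1 1%g) => [|s]; last first.
    rewrite [RHS](_ : _ = true); last by apply/eqP/permP => -[].
    by apply/andP; split; apply/forallP => -[].
  by rewrite odd_perm1 expr0 mul1r big_ord0.
have eM' : ~~ odd M by move: eM; rewrite /= negbK.
have f1inj : injective (f \o lift ord0) by apply: inj_comp => //; apply: lift_inj.
set A := (f \o lift ord0) @: setT.
have AE : (f \o lift ord0) @: setT = A by [].
have fT : f @: setT = f ord0 |: A by exact: imset_lift0.
have cA : #|A| = M.+1 by rewrite card_imset // cardsT card_ord.
have f0A : f ord0 \notin A.
  by apply/imsetP => -[k _ /finj/eqP]; apply/negP; apply: neq_lift.
have gf : generic t x (f ord0 |: A) by rewrite -fT.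
have [x0 xi x1 xt xq] := gf.
have f0in : f ord0 \in f ord0 |: A by rewrite !inE eqxx.
have fA k : f (lift ord0 k) \in f ord0 |: A.
  by rewrite in_setU1 (imset_f (f \o lift ord0)) ?inE ?orbT.
have xf0 k : x (f ord0) - x (f (lift ord0 k)) != 0.
  by apply: (generic_setU1_neq f0A gf); apply: (imset_f (f \o lift ord0)).
have x1f k : 1 - x (f ord0) * x (f (lift ord0 k)) != 0 by rewrite x1.
have xtf k : 1 - t * x (f ord0) * x (f (lift ord0 k)) != 0 by rewrite xt.
have big_A (F : 'I_N -> K) : \prod_(k in A) F k = \prod_(k < M.+1) F (f (lift ord0 k)).
  rewrite -AE big_imset /=; last by move=> i j _ _ /f1inj.
  by apply: eq_bigl => k; rewrite inE.
have sum_A (F : 'I_N -> K) : \sum_(k in A) F k = \sum_(k < M.+1) F (f (lift ord0 k)).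
  rewrite -AE big_imset /=; last by move=> i j _ _ /f1inj.
  by apply: eq_bigl => k; rewrite inE.
have f2inj j : injective (f \o lift2 j).
  by apply: inj_comp => // k l /lift_inj/lift_inj.
have Aj j : A :\ f (lift ord0 j) = (f \o lift2 j) @: setT.
  by rewrite -AE -[f (lift _ _)]/((f \o lift ord0) j) imset_liftD1.
have big_Aj j (F : 'I_N -> K) :
    \prod_(k in A :\ f (lift ord0 j)) F k = \prod_(k < M) F (f (lift2 j k)).
  rewrite Aj big_imset /=; last by move=> i k _ _ /f2inj.
  by apply: eq_bigl => k; rewrite inE.
have oA : odd #|A| by rewrite cA.
have := hlF_expand t0 t1 beta_rec oA f0A gf.
rewrite fT big_A /expand_rhs sum_A => E.
have n0 : \prod_(k < M.+1)
     ((x (f ord0) - x (f (lift ord0 k))) * (1 - x (f (lift ord0 k)) * x (f ord0))) != 0.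
  by apply/prodf_neq0 => k _; rewrite mulf_neq0 // mulrC.
apply: (mulIf n0); rewrite E pf_expand // mulr_sumr mulr_suml; apply: eq_bigr => j _.
rewrite {1}Aj /expand_coef !big_Aj.
have /= <- := IHM M (ltnW (ltnSn _)) (f \o lift2 j) eM' (@f2inj j) _; last first.
  apply: generic_sub gf _; rewrite -Aj.
  by apply: subset_trans (subsetUr _ _); apply: subsetDl.
rewrite (eq_pf (B := antisym_mx (fun i k => pf_entry (x (f (lift2 j i))) (x (f (lift2 j k)))))); last first.
  by move=> k l; rewrite !mxE !lift2_ltn.
rewrite mxE /=.
rewrite (@prod_pairs_lift _ _ ord0 (fun i k => 1 - t * x (f i) * x (f k)) (fun i k => x (f i) - x (f k))); first last.
- by move=> i l; rewrite opprB.
- by move=> i l; ring.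
rewrite (@prod_pairs_lift _ _ j (fun i k => 1 - t * x (f (lift ord0 i)) * x (f (lift ord0 k))) (fun i k => x (f (lift ord0 i)) - x (f (lift ord0 k)))); first last.
- by move=> i l; rewrite opprB.
- by move=> i l; ring.
rewrite expr0 mul1r -/(lift2 j _).
set P1 := \prod_(k < M.+1) _; set P2 := \prod_(k < M) _.
set P3 := \prod_(i < M) \prod_(l < M | _) _; set P4 := \prod_(k < M.+1) _.
set P2' := \prod_(k < M) _.
set p := pf _; set P5 := \prod_(k < M) _.
have <- : P2 = P2' by apply: eq_bigr => k _; rewrite mulrAC.
have P14 : P1 * P4 = (1 - x (f ord0) * x (f (lift ord0 j))) *
    (1 - t * x (f ord0) * x (f (lift ord0 j))) * P5.
  rewrite -big_split /= (bigD1_ord j) //=; congr (_ * _); last apply: eq_bigr => k _.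
    by rewrite (mulrC (x (f (lift ord0 j)))); field.
  by rewrite /lift2 (mulrC (x (f (lift ord0 (lift j k))))) (mulrAC t); field.
have sgn : (-1) ^+ j * (-1) ^+ j = 1 :> K by rewrite -expr2 sqrr_sign.
transitivity ((-1) ^+ j * (-1) ^+ j * P2 * P3 * p * pf_entry (x (f ord0)) (x (f (lift ord0 j)))
   * (P1 * P4)); first by ring.
rewrite P14 sgn /pf_entry; field.
by rewrite x1f xtf.
Qed.

End PfaffianSide.

(** * Hall-Littlewood symmetrization *)

Lemma exchange_subset_elem_card (R : nmodType) (I : finType) (B : {set I}) (n : nat)
    (G : {set I} -> I -> R) :
  \sum_(S : {set I} | (S \subset B) && (#|S| == n.+1)) \sum_(i in S) G (S :\ i) i =
  \sum_(i in B) \sum_(S : {set I} | (S \subset B :\ i) && (#|S| == n)) G S i.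
Proof.
rewrite (exchange_big_dep (mem B)) /=; last by move=> S i /andP[/subsetP SB _] /SB.
apply: eq_bigr => i iB.
rewrite (reindex_onto (fun S => i |: S) (fun S => S :\ i)) /=; last first.
  by move=> S /andP[_ iS]; rewrite setD1K.
apply: eq_big => [S|S /andP[_ /eqP ->] //].
rewrite subUset sub1set iB !inE eqxx /= andbT subsetD1 cardsU1.
have [iS|iS] := boolP (i \in S); last by rewrite setU1D1 ?eqxx //= !andbT add1n eqSS.
rewrite !andbF; apply/negP => /andP[_ /eqP e].
by rewrite -e !inE eqxx in iS.
Qed.

Section HLSym.
Variables (K : fieldType) (N : nat) (t : K) (x : 'I_N -> K).
Implicit Types (A B S : {set 'I_N}) (l : seq nat).

(** The Hall-Littlewood symmetrization over the variables in [A], one position at a time: [i] is the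
    variable that receives the exponent [a]. *)
Fixpoint hlsym l A : K :=
  if l is a :: l' then
    \sum_(i in A) x i ^+ a * \prod_(j in A :\ i) kr t (x i) (x j) * hlsym l' (A :\ i)
  else 1.

Lemma hlsym_perm (M : nat) (f : 'I_M -> 'I_N) (e : nat -> nat) : injective f ->
  \sum_(w : 'S_M) ((\prod_(i < M) x (f (w i)) ^+ e i) *
     \prod_(i < M) \prod_(j < M | (i < j)%N) kr t (x (f (w i))) (x (f (w j)))) =
  hlsym (mkseq e M) (f @: setT).
Proof.
elim: M f e => [|M IHM] f e finj.
  rewrite (big_pred1 1%g) => [|s]; first by rewrite !big_ord0 mulr1.
  by apply/esym/eqP/permP => -[].
rewrite sum_perm_lift /= big_imset /=; last by move=> i j _ _ /finj.
rewrite [RHS](eq_bigl predT); last by move=> i; rewrite inE.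
apply: eq_bigr => j _.
have fjinj : injective (f \o lift j) by apply: inj_comp => //; apply: lift_inj.
have -> : [seq e i | i <- iota 1 M] = mkseq (e \o S) M.
  by rewrite /mkseq (iotaDl 1 0) -map_comp.
rewrite imset_liftD1 // -IHM // mulr_sumr; apply: eq_bigr => s _.
rewrite !big_ord_recl /= lift_perm_id.
rewrite [X in _ * (X * _)]big_mkcond big_ord_recl /= mul1r.
have -> : \prod_(k in (f \o lift j) @: setT) kr t (x (f j)) (x k) =
    \prod_(i < M) kr t (x (f j)) (x (f (lift_perm ord0 j s (lift ord0 i)))).
  rewrite big_imset /=; last by move=> i k _ _ /fjinj.
  rewrite (reindex_inj (@perm_inj _ s)) /=.
  by apply: eq_big => i; rewrite ?inE // lift_perm_lift.
rewrite -!mulrA; congr (_ * _); rewrite mulrCA; congr (_ * (_ * _)).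
  by apply: eq_bigr => i _; rewrite lift_perm_lift.
apply: eq_bigr => i _; rewrite big_mkcond big_ord_recl /= mul1r -big_mkcond /=.
by apply: eq_bigr => k _; rewrite !lift_perm_lift.
Qed.

(** [S] collects the variables that receive the exponents [l1]; the kernels between the two groups
    depend on [S] alone. *)
Lemma hlsym_cat l1 l2 A :
  hlsym (l1 ++ l2) A =
  \sum_(S : {set 'I_N} | (S \subset A) && (#|S| == size l1))
     krset t x S (A :\: S) * hlsym l1 S * hlsym l2 (A :\: S).
Proof.
elim: l1 A => [|a l1 IH] A /=.
  rewrite (big_pred1 set0) => [|S].
    by rewrite setD0 /krset big_set0 !mul1r.
  by rewrite cards_eq0 /=; case: eqVneq => [->|]; rewrite ?sub0set ?andbF.
pose G S i := krset t x (i |: S) (A :\: (i |: S)) *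
  (x i ^+ a * \prod_(j in S) kr t (x i) (x j) * hlsym l1 S) * hlsym l2 (A :\: (i |: S)).
transitivity (\sum_(S : {set 'I_N} | (S \subset A) && (#|S| == (size l1).+1))
  \sum_(i in S) G (S :\ i) i); last first.
  apply: eq_bigr => S _; rewrite mulr_sumr mulr_suml; apply: eq_bigr => i iS.
  by rewrite /G setD1K.
rewrite exchange_subset_elem_card; apply: eq_bigr => i iA.
rewrite IH mulr_sumr; apply: eq_bigr => S /andP[SA _].
have iS : i \notin S by move: SA; rewrite subsetD1 => /andP[].
rewrite /G krset_setU1l // (big_setID S) /= (setIidPr SA) setDDl; ring.
Qed.

Hypotheses (t1 : t != 1).

Lemma hl_vS m : hl_v t m.+1 = hl_v t m * ((1 - t ^+ m.+1) / (1 - t)).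
Proof. by rewrite /hl_v big_nat_recr. Qed.

Lemma hlsym_nseq0 A : {in A, forall i, x i != 0} -> {in A &, injective x} ->
  hlsym (nseq #|A| 0%N) A = hl_v t #|A|.
Proof.
move=> x0 xi; move: {-2}#|A| (erefl #|A|) => m.
elim: m A x0 xi => [|m IH] A x0 xi cA.
  by rewrite /hl_v big_geq.
rewrite hl_vS cA -(sum_kr t1 x0 xi) -cA mulr_sumr /=; apply: eq_bigr => i iA.
rewrite expr0 mul1r IH 1?mulrC //.
- by move=> j /setD1P[_ /x0].
- by move=> j k /setD1P[_ jA] /setD1P[_ kA]; apply: xi.
by move: cA; rewrite (cardsD1 i) iA => -[].
Qed.

Lemma hlsym_succ l A : #|A| = size l ->
  hlsym (map S l) A = (\prod_(i in A) x i) * hlsym l A.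
Proof.
elim: l A => [|a l IH] A /= cA.
  by rewrite (cards0_eq cA) big_set0 mulr1.
rewrite mulr_sumr; apply: eq_bigr => i iA.
rewrite IH; last by move: cA; rewrite (cardsD1 i) iA => -[].
by rewrite [in RHS](big_setD1 i) //= exprS; ring.
Qed.

Hypothesis tn : forall i, 1 - t ^+ i.+1 != 0.

Lemma hl_v_neq0 m : hl_v t m != 0.
Proof.
elim: m => [|m IH]; first by rewrite /hl_v big_geq ?oner_eq0.
by rewrite hl_vS !mulf_neq0 ?invr_eq0 ?tn // subr_eq0 eq_sym.
Qed.

(** The right side is a Gaussian binomial, [hl_v] being the t-factorial. A list of zero exponents is
    cut after [r] entries and all three symmetrizations are evaluated. *)
Lemma krset_binomial r A : {in A, forall i, x i != 0} -> {in A &, injective x} ->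
  (r <= #|A|)%N ->
  \sum_(S : {set 'I_N} | (S \subset A) && (#|S| == r)) krset t x S (A :\: S) =
  hl_v t #|A| / (hl_v t r * hl_v t (#|A| - r)%N).
Proof.
move=> x0 xi rA; have v0 := hl_v_neq0.
have := hlsym_cat (nseq r 0%N) (nseq (#|A| - r) 0%N) A.
rewrite -nseqD subnKC // hlsym_nseq0 // => ->.
rewrite mulr_suml size_nseq; apply: eq_bigr => S /andP[SA /eqP cS].
have SinA : {in S, forall i, i \in A} by apply/subsetP.
have DinA : {in A :\: S, forall i, i \in A} by move=> i /setDP[].
have -> : hlsym (nseq r 0%N) S = hl_v t r.
  rewrite -cS hlsym_nseq0 // => [i /SinA/x0 //|i j /SinA iA /SinA jA]; exact: xi.
have -> : hlsym (nseq (#|A| - r) 0%N) (A :\: S) = hl_v t (#|A| - r)%N.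
  rewrite -cS -cardsDsub // hlsym_nseq0 // => [i /DinA/x0 //|i j /DinA iA /DinA jA].
  exact: xi.
by field; rewrite !v0.
Qed.

End HLSym.

(** * The coefficient sequences *)

Section BetaSequence.
Variables (K : fieldType) (t u : K).
Hypotheses (t1 : t != 1) (tn : forall i, 1 - t ^+ i.+1 != 0).

(* The sequence whose transform sum_r [m choose r]_t beta1_r is 1 at m = 0 and 0
   otherwise; it satisfies the recursion with u = 1. *)
Definition beta1 r : K := \prod_(i < r) (- t ^+ i).

(* Odd k are given the value 0, so that subsets of odd size drop out of
   [hlF_beta_u]; both parities still satisfy [g_evenSS]. *)
Definition g_even (k : nat) : K :=
  if odd k then 0 else \prod_(i < k./2) (1 - u * t ^+ i.*2).

Definition beta_u m : K :=
  hl_v t m * \sum_(r < m.+1) (beta1 r / hl_v t r) * (g_even (m - r) / hl_v t (m - r)).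

Definition qn m : K := (1 - t ^+ m) / (1 - t).

Lemma g_evenSS k : g_even k.+2 = (1 - u * t ^+ k) * g_even k.
Proof.
rewrite /g_even /= negbK; case: ifP => [_|ok]; first by rewrite mulr0.
by rewrite big_ord_recr /= mulrC even_halfK ?ok.
Qed.

Lemma beta_u0 : beta_u 0 = 1.
Proof.
rewrite /beta_u big_ord_recl big_ord0 /beta1 /g_even /hl_v /= !big_geq // !big_ord0.
by rewrite !(mul1r, divr1, addr0) invr1.
Qed.

Lemma qnD m r : (r <= m)%N -> qn m = qn r + t ^+ r * qn (m - r).
Proof.
move=> rm; rewrite -{1}(subnKC rm) /qn exprD; field.
by rewrite subr_eq0 eq_sym.
Qed.

(** Divided by [hl_v], the sequence is the ordinary convolution [b] of [d] and [g]. By [qnD] the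
    t-integer of the total index splits into a part at [d] and a part at [g], where the one-step
    relation [dS] and the two-step relation [gS] apply. *)
Lemma beta_u_rec m :
  beta_u m.+2 = - (1 + t ^+ m.+1) * beta_u m.+1 - u * t ^+ m * beta_u m.
Proof.
have v0 := hl_v_neq0 t1 tn.
have t1' : 1 - t != 0 by rewrite subr_eq0 eq_sym.
pose d r := beta1 r / hl_v t r; pose g k := g_even k / hl_v t k.
pose b n := \sum_(r < n.+1) d r * g (n - r)%N.
have dS r : qn r.+1 * d r.+1 = - t ^+ r * d r.
  rewrite /d /beta1 hl_vS big_ord_recr /= /qn; field.
  by rewrite v0 t1' tn.
have gS k : qn k.+1 * (qn k.+2 * g k.+2) = (1 - u * t ^+ k) * g k.
  rewrite /g !hl_vS g_evenSS /qn; field.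
  by rewrite v0 t1' !tn.
have qn0 : qn 0 = 0 by rewrite /qn subrr mul0r.
have shift n (h : nat -> K) :
    \sum_(r < n.+1) qn r * d r * h r = - \sum_(r < n) t ^+ r * d r * h r.+1.
  rewrite big_ord_recl qn0 !mul0r add0r -sumrN; apply: eq_bigr => r _.
  by rewrite /= dS !mulNr.
pose a r := g (m - r)%N; pose c r := qn (m.+1 - r) * g (m.+1 - r)%N.
have b1 n : qn n.+1 * b n.+1 =
    \sum_(r < n.+1) t ^+ r * d r * (qn (n.+1 - r) * g (n.+1 - r)%N - g (n - r)%N).
  transitivity (\sum_(r < n.+2) qn r * d r * g (n.+1 - r)%N
       + \sum_(r < n.+2) t ^+ r * d r * (qn (n.+1 - r) * g (n.+1 - r)%N)).
    rewrite mulr_sumr -big_split; apply: eq_bigr => r _ /=.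
    by rewrite (@qnD n.+1 r) ?leq_ord //; ring.
  rewrite (shift n.+1 (fun r => g (n.+1 - r)%N)).
  rewrite [X in _ + X]big_ord_recr /= subnn qn0 mul0r mulr0 addr0 addrC -sumrB.
  by apply: eq_bigr => r _; rewrite subSS mulrBr.
have b2 : qn m.+1 * (qn m.+2 * b m.+2) =
    \sum_(r < m.+1) t ^+ r * d r *
       (- t ^+ r.+1 * (c r - a r) + t ^+ r * ((1 - u * t ^+ (m - r)) * a r - c r)).
  rewrite b1 mulr_sumr.
  transitivity (\sum_(r < m.+2) qn r * d r * (t ^+ r * (qn (m.+2 - r) * g (m.+2 - r)%N - g (m.+1 - r)%N))
    + \sum_(r < m.+2) t ^+ r * d r * t ^+ r * (qn (m.+1 - r) * (qn (m.+2 - r) * g (m.+2 - r)%N - g (m.+1 - r)%N))).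
    rewrite -big_split; apply: eq_bigr => r _ /=.
    by rewrite (@qnD m.+1 r) ?leq_ord //; ring.
  rewrite (shift m.+1 (fun r => t ^+ r * (qn (m.+2 - r) * g (m.+2 - r)%N - g (m.+1 - r)%N))).
  rewrite [X in _ + X]big_ord_recr /= subnn qn0 mul0r mulr0 addr0 addrC -sumrB.
  apply: eq_bigr => r _; rewrite !subSS /c /a.
  have rm : (r <= m)%N by rewrite -ltnS.
  rewrite -gS !(subSn rm) (subSn (leqW rm)) (subSn rm); ring.
(* Summation by parts: [shift] trades [t ^+ r * d r] for its neighbour [qn r.+1 * d r.+1], and then
   the terms cancel for each index by [gS]. *)
have key : \sum_(r < m.+1) t ^+ r * d r * (c r - a r) * (qn r - t ^+ r.+1 * qn (m - r))
    + u * t ^+ m * \sum_(r < m.+1) qn r * d r * a r = 0.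
  transitivity (\sum_(r < m.+1) qn r * d r * (t ^+ r * (c r - a r))
    - \sum_(r < m.+1) t ^+ r * d r * (t ^+ r.+1 * (qn (m - r) * (c r - a r)))
    + u * t ^+ m * \sum_(r < m.+1) qn r * d r * a r).
    by congr (_ + _); rewrite -sumrB; apply: eq_bigr => r _; ring.
  rewrite [X in _ - X]big_ord_recr /= subnn qn0 mul0r !mulr0 addr0.
  have -> : \sum_(r < m) t ^+ r * d r * (t ^+ r.+1 * (qn (m - r) * (c r - a r))) =
     - \sum_(r < m.+1) qn r * d r * (t ^+ r * (qn (m.+1 - r) * (c r.-1 - a r.-1))).
    by rewrite (shift m (fun r => t ^+ r * (qn (m.+1 - r) * (c r.-1 - a r.-1)))) opprK.
  rewrite opprK mulr_sumr -!big_split big1 // => r _ /=.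
  case: r => -[|r] /= rm; first by rewrite qn0 !mul0r mulr0 !addr0.
  have rm' : (r < m)%N by [].
  rewrite subSS /c /a !subSS -[(m - r)%N]subnSK // (subSn (ltnW rm')) -[(m - r)%N]subnSK //.
  set k := (m - r.+1)%N.
  have -> : t ^+ m = t ^+ r.+1 * t ^+ k by rewrite -exprD subnKC.
  have := gS k; set Q := qn k.+2; set q := qn k.+1; set G := g k.+2 => e.
  transitivity (qn r.+1 * d r.+1 * t ^+ r.+1 * (q * (Q * G) - (1 - u * t ^+ k) * g k)); first by ring.
  by rewrite e subrr mulr0.
have vE : hl_v t m.+2 = hl_v t m * qn m.+1 * qn m.+2 by rewrite !hl_vS.
have vE1 : hl_v t m.+1 = hl_v t m * qn m.+1 by rewrite !hl_vS.
rewrite /beta_u -!/(b _) vE vE1 -/(b m.+2) -/(b m.+1) -/(b m).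
suff E : qn m.+1 * (qn m.+2 * b m.+2) =
    - (1 + t ^+ m.+1) * (qn m.+1 * b m.+1) - u * t ^+ m * b m.
  transitivity (hl_v t m * (qn m.+1 * (qn m.+2 * b m.+2))); first by ring.
  by rewrite E; ring.
(* The two sides differ by [(1 - t)] times the vanishing sum [key]; once it is added, the identity
   holds for each [r]. *)
rewrite -[RHS]addr0 -[X in _ = _ + X](mulr0 (1 - t)) -key b2 b1.
rewrite /b !mulrDr !mulr_sumr -sumrN -!big_split; apply: eq_bigr => r _ /=.
have rm : (r <= m)%N by rewrite -ltnS.
have tm1 : t ^+ m.+1 = t * (t ^+ r * t ^+ (m - r)) by rewrite -exprD subnKC // exprS.
have tm : t ^+ m = t ^+ r * t ^+ (m - r) by rewrite -exprD subnKC.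
rewrite -/(a r) -/(c r) tm1 tm /qn !exprS; field.
by rewrite t1'.
Qed.

End BetaSequence.

(** * Composition of kernels *)

Section KernelExpansion.
Variables (K : fieldType) (N : nat) (t : K) (x : 'I_N -> K).
Hypotheses (t1 : t != 1) (tn : forall i, 1 - t ^+ i.+1 != 0).
Implicit Types (A B S T J : {set 'I_N}).

(** In the double sum over [J] inside [S], put [S = J :|: A]. The kernels between [J], [A] and the
    rest regroup as a cut of [T] at [J] and one of [T :\: J] at [A]. For [A] of fixed size the
    second sums to a Gaussian binomial, so the coefficient of the first is [beta_u]. *)
Lemma hlF_beta_u u T : {in T, forall i, x i != 0} -> {in T &, injective x} ->
  hlF t x (beta_u t u) T =
  \sum_(S : {set 'I_N} | S \subset T)
     g_even t u (#|T| - #|S|) * krset t x S (T :\: S) * hlF t x (beta1 t) S.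
Proof.
move=> x0 xi; have v0 := hl_v_neq0 t1 tn; rewrite /hlF.
under [RHS]eq_bigr do rewrite mulr_sumr.
rewrite [RHS](exchange_big_dep (fun J => J \subset T)) /=; last first.
  by move=> S J ST JS; apply: subset_trans JS ST.
apply: eq_bigr => J JT.
rewrite (reindex_onto (fun A => J :|: A) (fun S => S :\: J)) /=; last first.
  by move=> S /andP[_ JS]; rewrite -{1}(setIidPr JS) setID.
set m := #|T :\: J|.
have mE : m = (#|T| - #|J|)%N by exact: cardsDsub.
transitivity (\sum_(A : {set 'I_N} | A \subset T :\: J)
    g_even t u (m - #|A|) * beta1 t #|A| * (krset t x A ((T :\: J) :\: A) * cut t x T J)).
  rewrite (partition_big (fun A : {set 'I_N} => inord #|A| : 'I_m.+1) predT) //=.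
  rewrite /beta_u -mE mulr_sumr mulr_suml; apply: eq_bigr => r _.
  rewrite (eq_bigl (fun A : {set 'I_N} => (A \subset T :\: J) && (#|A| == r))); last first.
    move=> A; apply: andb_id2l => AT; rewrite -val_eqE /= inordK //.
    by rewrite ltnS subset_leq_card.
  transitivity (g_even t u (m - r) * beta1 t r * cut t x T J *
     \sum_(A : {set 'I_N} | (A \subset T :\: J) && (#|A| == r))
        krset t x A ((T :\: J) :\: A)); last first.
    by rewrite mulr_sumr; apply: eq_bigr => A /andP[_ /eqP ->]; ring.
  rewrite krset_binomial // -/m; last by rewrite -ltnS.
  - by field; rewrite !v0.
  - by move=> i /setDP[/x0].
  by move=> i j /setDP[iT _] /setDP[jT _]; apply: xi.
apply: eq_big => [A|A AT].
  rewrite subUset JT subsetUl /= andbT setDUl setDv set0U.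
  rewrite subsetD (_ : [disjoint A & J] = (A :\: J == A)) //.
  by apply/setDidPl/eqP.
have AJ : [disjoint A & J] by move: AT; rewrite subsetD => /andP[].
have JA : [disjoint J & A] by rewrite disjoint_sym.
have cJA : #|J :|: A| = (#|J| + #|A|)%N by rewrite cardsU (disjoint_setI0 JA) cards0 subn0.
rewrite cJA addKn subnDA -mE.
have krU : krset t x (J :|: A) (T :\: (J :|: A)) * krset t x J A =
   krset t x A (T :\: J :\: A) * krset t x J (T :\: J).
  have -> : krset t x (J :|: A) (T :\: (J :|: A)) =
      krset t x J (T :\: J :\: A) * krset t x A (T :\: J :\: A).
    rewrite /krset (big_setID J) /= setIUl setIid (setIC A) (disjoint_setI0 JA) setU0.
    by rewrite setDUl setDv set0U (setDidPl AJ) setDDl.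
  have -> : krset t x J (T :\: J) = krset t x J A * krset t x J (T :\: J :\: A).
    rewrite /krset -big_split; apply: eq_bigr => i _ /=.
    by rewrite (big_setID A) /= (setIidPr AT).
  by ring.
rewrite /cut setDUl setDv set0U (setDidPl AJ).
transitivity (g_even t u (m - #|A|) * beta1 t #|A| * frset t x J *
  (krset t x A (T :\: J :\: A) * krset t x J (T :\: J))); first by ring.
by rewrite -krU; ring.
Qed.

End KernelExpansion.

(** * The column recursion for F_beta *)

Section ColumnRecursion.
Variables (K : fieldType) (N : nat) (t : K) (x : 'I_N -> K).
Hypotheses (t0 : t != 0) (t1 : t != 1) (tn : forall i, 1 - t ^+ i.+1 != 0).
Implicit Types (A B S T J : {set 'I_N}).

Lemma beta1_rec r : beta1 t r.+2 = - (1 + t ^+ r.+1) * beta1 t r.+1 - 1 * t ^+ r * beta1 t r.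
Proof. by rewrite /beta1 !big_ord_recr /= !exprS; ring. Qed.

Lemma beta1_0 : beta1 t 0 = 1. Proof. by rewrite /beta1 big_ord0. Qed.

(** The factor 1 - u + (u - t) x_a x_j of the expansion is (1 - t) x_a x_j at u = 1 and 1 - t at u =
    t. Each expansion step thus gains x_a x_j, and [beta1] solves the recursion for u = 1. *)
Lemma hlF_beta1 S : ~~ odd #|S| -> generic t x S ->
  hlF t x (beta1 t) S = (\prod_(i in S) x i) * hlF t x (beta_u t t) S.
Proof.
have [n] := ubnP #|S|; elim: n S => // n IHn S ltSn eS gS.
have [->|[a aS]] := set_0Vmem S.
  by rewrite !hlF0 ?big_set0 ?mul1r ?beta1_0 ?beta_u0.
rewrite -(setD1K aS); set A := S :\ a.
have aA : a \notin A by rewrite !inE eqxx.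
have gA : generic t x (a |: A) by rewrite setD1K.
have oA : odd #|A| by move: eS; rewrite (cardsD1 a) aS negbK.
have [x0 _ x1 _ _] := gA.
have n0 : \prod_(k in A) ((x a - x k) * (1 - x k * x a)) != 0.
  apply/prodf_neq0 => k kA; rewrite mulf_neq0 //; first exact: generic_setU1_neq gA kA.
  by rewrite x1 ?in_setU1 ?kA ?orbT ?eqxx.
apply: (mulIf n0); rewrite (hlF_expand t0 t1 beta1_rec oA aA gA).
rewrite -mulrA (hlF_expand t0 t1 (beta_u_rec t t1 tn) oA aA gA) /expand_rhs mulr_sumr.
apply: eq_bigr => j jA; rewrite IHn.
- by rewrite big_setU1 //= [\prod_(i in A) x i](big_setD1 j) //=; ring.
- move: ltSn; rewrite (cardsD1 a) aS (cardsD1 j A) jA !add1n ltnS.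
  exact: leq_trans.
- by move: oA; rewrite (cardsD1 j) jA.
by apply: generic_sub gA _; rewrite subDset subsetU // subsetUr orbT.
Qed.

Lemma hlF_column u T : ~~ odd #|T| -> generic t x T ->
  hlF t x (beta_u t u) T =
  \sum_(S : {set 'I_N} | (S \subset T) && ~~ odd #|S|)
     g_even t u (#|T| - #|S|) * krset t x S (T :\: S) *
       ((\prod_(i in S) x i) * hlF t x (beta_u t t) S).
Proof.
move=> eT gT; have [x0 xi _ _ _] := gT.
rewrite (hlF_beta_u t1 tn) // (bigID (fun S : {set 'I_N} => odd #|S|)) /= big1 ?add0r.
  apply: eq_bigr => S /andP[ST eS]; rewrite hlF_beta1 //.
  exact: generic_sub ST.
move=> S /andP[ST oS]; rewrite /g_even oddB ?subset_leq_card // oS (negPf eT).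
by rewrite !mul0r.
Qed.

(** * Adding and removing a column of a partition *)

(** Puts a column of length [l] in front of [mu]; the zeros that pad [mu] to length [l] become parts
    1. *)
Definition colup (l : nat) (mu : seq nat) := [seq p.+1 | p <- mu] ++ nseq (l - size mu) 1%N.

Definition vprod (M : nat) (la : seq nat) : K :=
  \prod_(0 <= i < (head 0%N la).+1) hl_v t (mult M la i).

Definition gprod (u : K) (m : nat) : K :=
  \prod_(2 <= j < m.+1 | ~~ odd j) (1 - u * t ^+ (j - 2)).

(** The Hall-Littlewood polynomial in the variables indexed by [T]. *)
Definition hlP (la : seq nat) T : K :=
  (vprod #|T| la)^-1 * hlsym t x (mkseq (nth 0%N la) #|T|) T.

(** The weight of [la] in [M] variables; [u] is a parameter because the column recursion passes from
    [u] to [t]. *)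
Definition hlw (u : K) M (la : seq nat) : K := gprod u (mult M la 0) * b_el t la.

Lemma gprod_even u m : ~~ odd m -> gprod u m = g_even t u m.
Proof.
move=> em; rewrite /g_even (negPf em).
have {em} [k ->] : exists k, m = k.*2 by exists m./2; rewrite even_halfK.
rewrite doubleK; elim: k => [|k IH]; first by rewrite /gprod big_geq // big_ord0.
rewrite /gprod doubleS big_mkcond big_nat_recr //= negbK odd_double /= subSS subn1 /=.
rewrite big_ord_recr /= -IH /gprod; congr (_ * _).
case: (k) => [|k']; first by rewrite !big_geq.
by rewrite doubleS big_nat_recr //= odd_double /= mulr1 -big_mkcond.
Qed.

Lemma count_colup l mu i : 0%N \notin mu ->
  count_mem i.+1 (colup l mu) = if i == 0%N then (l - size mu)%N else count_mem i mu.
Proof.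
move=> mu0; rewrite count_cat count_map count_nseq.
rewrite (eq_count (a2 := pred1 i)); last by move=> j /=; rewrite eqSS.
case: eqP => [->|i0] /=; last first.
  by case: i i0 => // i _; rewrite mul0n addn0.
by rewrite mul1n (count_memPn mu0).
Qed.

Lemma size_colup l mu : (size mu <= l)%N -> size (colup l mu) = l.
Proof. by move=> ml; rewrite size_cat size_map size_nseq subnKC. Qed.

Lemma head_colup l mu : (size mu <= l)%N -> (0 < l)%N ->
  head 0%N (colup l mu) = (head 0%N mu).+1.
Proof. by case: mu => [|a mu] //= _; case: l. Qed.

(** The parts 1 of the new partition are the zeros of [mu] in [l] variables, and 1 - t^(j-1) = 1 - t
    t^(j-2). Their factor is therefore the u-weight of [mu] at u = t, which is why the recursion
    continues with that value. *)
Lemma b_el_colup l mu : (size mu <= l)%N -> 0%N \notin mu ->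
  b_el t (colup l mu) = hlw t l mu.
Proof.
move=> ml mu0; rewrite /hlw /mult /= /gprod.
have [l0|lpos] := posnP l.
  have -> : mu = [::] by case: (mu) ml; rewrite ?l0.
  by rewrite l0 /b_el /colup /= !big_geq // mulr1.
rewrite {1}/b_el head_colup // big_nat_recl // count_colup //=.
congr (_ * _).
  rewrite big_nat_cond [RHS]big_nat_cond; apply: eq_bigr => j /andP[/andP[j2 _] _].
  by rewrite -exprS; congr (1 - t ^+ _); lia.
rewrite /b_el; rewrite big_nat [RHS]big_nat; apply: eq_bigr => i /andP[i0 _].
by rewrite count_colup //= eqn0Ngt i0.
Qed.

Lemma vprod_colup M l mu : (size mu <= l)%N -> (l <= M)%N -> 0%N \notin mu ->
  vprod M (colup l mu) = hl_v t (M - l) * vprod l mu.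
Proof.
move=> ml lM mu0; rewrite /vprod.
have [l0|lpos] := posnP l.
  have -> : mu = [::] by case: (mu) ml; rewrite ?l0.
  by rewrite l0 /colup /= !big_nat1 /mult /= subn0 [hl_v t 0]/hl_v big_geq // mulr1.
rewrite head_colup // big_nat_recl // /mult /= size_colup //; congr (_ * _).
rewrite big_nat [RHS]big_nat; apply: eq_bigr => i _; rewrite count_colup //.
Qed.

Lemma mkseq_colup M l mu : (size mu <= l)%N -> (l <= M)%N ->
  mkseq (nth 0%N (colup l mu)) M = map S (mkseq (nth 0%N mu) l) ++ nseq (M - l) 0%N.
Proof.
move=> ml lM; apply: (@eq_from_nth _ 0%N).
  by rewrite size_cat size_map !size_mkseq size_nseq subnKC.
move=> i; rewrite size_mkseq => iM; rewrite nth_mkseq // nth_cat size_map size_mkseq.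
case: ltnP => il.
  rewrite (nth_map 0%N) ?size_mkseq // nth_mkseq // /colup nth_cat size_map.
  case: ltnP => imu; first by rewrite (nth_map 0%N).
  by rewrite nth_nseq ltn_sub2r // ?(leq_ltn_trans imu) // nth_default.
by rewrite nth_nseq if_same nth_default // size_colup.
Qed.

Lemma vprod_neq0 M la : vprod M la != 0.
Proof.
by rewrite /vprod prodf_seq_neq0; apply/allP => i _; rewrite implyTb hl_v_neq0.
Qed.

(* Reads off the partition whose first column has length l: S indexes the variables
   carrying its nonzero parts. *)
Lemma hlP_colup u l mu T : ~~ odd #|T| -> ~~ odd l -> generic t x T ->
    (size mu <= l)%N -> (l <= #|T|)%N -> 0%N \notin mu ->
  hlw u #|T| (colup l mu) * hlP (colup l mu) T =
  \sum_(S : {set 'I_N} | (S \subset T) && (#|S| == l))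
     g_even t u (#|T| - #|S|) * krset t x S (T :\: S) *
       ((\prod_(i in S) x i) * (hlw t #|S| mu * hlP mu S)).
Proof.
move=> eT el gT ml lT mu0; have [x0 xi _ _ _] := gT.
rewrite {1}/hlw /mult /= size_colup // gprod_even; last by rewrite oddB // (negPf eT).
rewrite b_el_colup // /hlP vprod_colup // mkseq_colup // hlsym_cat !mulr_sumr.
rewrite size_map size_mkseq; apply: eq_bigr => S /andP[ST /eqP cS].
rewrite hlsym_succ ?size_mkseq // -cS -cardsDsub // hlsym_nseq0 //.
- by field; rewrite vprod_neq0 hl_v_neq0.
- by move=> i /setDP[/x0].
by move=> i j /setDP[iT _] /setDP[jT _]; apply: xi.
Qed.

Lemma hlP_nil u T : {in T, forall i, x i != 0} -> {in T &, injective x} ->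
  hlw u #|T| [::] * hlP [::] T = gprod u #|T|.
Proof.
move=> x0 xi; rewrite /hlw /hlP /vprod /b_el /= big_geq // big_nat1 /mult /= subn0 mulr1.
have -> : mkseq (nth 0%N [::]) #|T| = nseq #|T| 0%N.
  apply: (@eq_from_nth _ 0%N); rewrite size_mkseq ?size_nseq // => i iT.
  by rewrite nth_mkseq // nth_nseq nth_nil if_same.
by rewrite hlsym_nseq0 // mulVf ?mulr1 // hl_v_neq0.
Qed.

End ColumnRecursion.

(** * Enumeration of the partitions with even columns *)

Fixpoint evcols (d M : nat) : seq (seq nat) :=
  if d is d'.+1 then
    flatten [seq [seq colup l mu | mu <- evcols d' l] | l <- iota 0 M.+1 & ~~ odd l]
  else [:: [::]].

Definition even_partition M (l : seq nat) :=
  [&& is_partition l, (size l <= M)%N & all (fun p => ~~ odd p) (conj_partition l)].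

Lemma conj_colup l mu : (size mu <= l)%N -> (0 < l)%N -> 
  conj_partition (colup l mu) = l :: conj_partition mu.
Proof.
move=> ml lpos; rewrite /conj_partition head_colup //= (iotaDl 1 0) -map_comp.
congr (_ :: _).
  rewrite count_cat count_map count_nseq mul1n (eq_count (a2 := predT)) //.
  by rewrite count_predT subnKC.
apply: eq_map => i /=; rewrite count_cat count_map count_nseq mul0n addn0.
by apply: eq_count => j /=; rewrite ltnS.
Qed.

Lemma evcolsS d M : evcols d.+1 M =
  flatten [seq [seq colup l mu | mu <- evcols d l] | l <- iota 0 M.+1 & ~~ odd l].
Proof. by []. Qed.

Lemma geq_trans : transitive geq.
Proof. by move=> a b c /= ab ca; apply: leq_trans ca ab. Qed.

Lemma sorted_colup l mu : sorted geq mu -> sorted geq (colup l mu).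
Proof.
rewrite !(sorted_pairwise geq_trans) /colup pairwise_cat pairwise_map => smu.
apply/and3P; split; last first.
- by elim: (l - size mu)%N => //= k ->; rewrite andbT; apply/allP => y /nseqP[->].
- exact: smu.
by apply/allrelP => p q /mapP[p' _ ->] /nseqP[-> _].
Qed.

(** Removes the first column, so that parts 1 disappear instead of becoming zeros. *)
Definition coldown (la : seq nat) := [seq p.-1 | p <- la & (1 < p)%N].

Lemma size_coldown la : (size (coldown la) <= size la)%N.
Proof. by rewrite size_map size_filter count_size. Qed.

Lemma coldownK la : sorted geq la -> 0%N \notin la -> colup (size la) (coldown la) = la.
Proof.
elim: la => [|a la IH] //= pla; rewrite inE => /norP[a0 la0].
have sla := path_sorted pla; have := IH sla la0.
rewrite /coldown /=; case: (ltnP 1 a) => a1.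
  rewrite /colup /= subSS => ->.
  by rewrite prednK // ltnW.
have a1' : a = 1%N by case: a a0 a1 {pla} => [|[]].
move: pla; rewrite a1' (path_sortedE geq_trans) => /andP[/allP le1 _].
have -> : [seq x <- la | (1 < x)%N] = [::].
  by apply/eqP; rewrite -[_ == _]negbK -has_filter; apply/hasPn => y /le1; rewrite -leqNgt.
by rewrite /colup /= !subn0 => {2}<-.
Qed.

Lemma sorted_coldown la : sorted geq la -> sorted geq (coldown la).
Proof.
rewrite !(sorted_pairwise geq_trans) /coldown pairwise_map => sla.
apply: (sub_pairwise (r := geq)); last by apply: pairwise_filter.
by move=> p q /= qp; lia.
Qed.

Lemma coldown_neq0 la : 0%N \notin coldown la.
Proof.
by apply/mapP => -[p]; rewrite mem_filter => /andP[p1 _] /esym/eqP; rewrite -leqn0; lia.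
Qed.

Lemma evcolsP d M la :
  (la \in evcols d M) = even_partition M la && (head 0%N la <= d)%N.
Proof.
elim: d M la => [|d IH] M la.
  rewrite inE; apply/eqP/andP => [->|[/and3P[/andP[_ la0] _ _]]]; first by [].
  by case: la la0 => // a la; rewrite inE /= leqn0 eq_sym => /norP[/negPf->].
rewrite evcolsS; apply/flatten_mapP/andP => [[l]|].
  rewrite mem_filter mem_iota leq0n add0n ltnS andTb => /andP[el lM] /mapP[mu + ->].
  rewrite IH => /andP[/and3P[/andP[smu mu0] ml cmu] hmu].
  have [l0|lpos] := posnP l.
    have -> : mu = [::] by case: (mu) ml; rewrite ?l0.
    by rewrite l0.
  rewrite head_colup // ltnS hmu; split=> //.
  rewrite /even_partition size_colup // lM conj_colup //= el cmu andbT.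
  rewrite !andbT /is_partition sorted_colup //= /colup mem_cat negb_or mem_nseq andbF andbT.
  by apply/mapP => -[].
move=> [/and3P[/andP[sla la0] lM cla] hla].
have e := coldownK sla la0; have mu0 := coldown_neq0 la.
have sm := size_coldown la; have smu := sorted_coldown sla.
exists (size la).
  rewrite mem_filter mem_iota leq0n add0n ltnS andTb lM andbT /=.
  have [->//|lpos] := posnP (size la).
  by move: cla; rewrite -{1}e conj_colup //= => /andP[].
rewrite -{1}e; apply: map_f; rewrite IH /even_partition /is_partition smu mu0 sm /=.
have [l0|lpos] := posnP (size la); first by rewrite (size0nil l0).
move: cla hla; rewrite -{1 2}e conj_colup // head_colup //= ltnS => /andP[_ ->] ->.
by [].
Qed.

Lemma colupK l mu : 0%N \notin mu -> coldown (colup l mu) = mu.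
Proof.
move=> mu0; rewrite /coldown filter_cat filter_map map_cat -map_comp.
rewrite (eq_map (g := id)) // map_id.
rewrite (eq_in_filter (a2 := predT)); last first.
  by move=> p pmu /=; rewrite ltnS lt0n; apply: contraNneq mu0 => <-.
by rewrite filter_predT; elim: (l - size mu)%N; rewrite ?cats0.
Qed.

Lemma evcols_uniq d M : uniq (evcols d M).
Proof.
elim: d M => [|d IH] M //; rewrite evcolsS; apply: allpairs_uniq_dep => //.
  by rewrite filter_uniq ?iota_uniq.
move=> _ _ /allpairsPdep[l [mu [_ + ->]]] /allpairsPdep[l' [mu' [_ + ->]]] /=.
rewrite !evcolsP => /andP[/and3P[/andP[_ m0] ml _] _] /andP[/and3P[/andP[_ m0'] ml' _] _] e.
have el : l = l' by rewrite -(size_colup ml) e size_colup.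
by subst l'; congr Tagged; rewrite -(colupK l m0) e colupK.
Qed.

Lemma big_evcols (V : nmodType) d M (F : seq nat -> V) :
  \sum_(la <- evcols d.+1 M) F la =
  \sum_(l < M.+1 | ~~ odd l) \sum_(mu <- evcols d l) F (colup l mu).
Proof.
rewrite evcolsS big_flatten big_map big_filter -[iota 0 M.+1]/(index_iota 0 M.+1).
by rewrite big_mkord; apply: eq_bigr => l _; rewrite big_map.
Qed.

Import Order.TTheory.

(** * The order valuation on the fraction field *)

Section Valuation.
Variables (n : nat) (R : idomainType).
Implicit Types (f g : mps n R) (m k : 'X_{1..n}) (d e : nat) (F G : {fraction mps n R}).

Definition ord_ge d f := forall m, (mdeg m < d)%N -> pscoef f m = 0.

Lemma pscoefD f g m : pscoef (f + g) m = pscoef f m + pscoef g m. Proof. by []. Qed.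
Lemma pscoefN f m : pscoef (- f) m = - pscoef f m. Proof. by []. Qed.
Lemma pscoefE (f g : mps n R) m : pscoef (f * g) m =
  \sum_(k : 'X_{1..n < (mdeg m).+1, (mdeg m).+1} | m == (k.1 + k.2)%MM)
    pscoef f k.1 * pscoef g k.2.
Proof. by []. Qed.
Lemma pscoef1 m : pscoef (1 : mps n R) m = (m == 0%MM)%:R.
Proof. by []. Qed.

Lemma pscoef_sum (I : Type) (r : seq I) (P : pred I) (h : I -> mps n R) m :
  pscoef (\sum_(i <- r | P i) h i) m = \sum_(i <- r | P i) pscoef (h i) m.
Proof. by elim/big_rec2: _ => // i x f _ <-. Qed.

Lemma ord_geW d e f : (d <= e)%N -> ord_ge e f -> ord_ge d f.
Proof. by move=> de fe m md; apply: fe; apply: leq_trans md de. Qed.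

Lemma ord_geD d f g : ord_ge d f -> ord_ge d g -> ord_ge d (f + g).
Proof. by move=> fd gd m md; rewrite pscoefD fd ?gd ?addr0. Qed.

Lemma ord_geN d f : ord_ge d f -> ord_ge d (- f).
Proof. by move=> fd m md; rewrite pscoefN fd ?oppr0. Qed.

Lemma ord_geM d e f g : ord_ge d f -> ord_ge e g -> ord_ge (d + e) (f * g).
Proof.
move=> fd ge m md; rewrite pscoefE big1 // => -[k1 k2] /= /eqP mE.
have [k1d|k1d] := ltnP (mdeg k1) d; first by rewrite fd ?mul0r.
have [k2e|k2e] := ltnP (mdeg k2) e; first by rewrite (ge k2) ?mulr0.
by have := leq_add k1d k2e; rewrite -mdegD -mE leqNgt md.
Qed.

Definition lowest f m := pscoef f m != 0 /\ forall k, (k < m)%O -> pscoef f k = 0.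

Lemma lowestM f g a b : lowest f a -> lowest g b -> lowest (f * g) (a + b)%MM.
Proof.
move=> [nz_fa lt_fa] [nz_gb lt_gb]; split.
  have lt_ad : (mdeg a < (mdeg (a + b)%MM).+1)%N by rewrite ltnS mdegD leq_addr.
  have lt_bd : (mdeg b < (mdeg (a + b)%MM).+1)%N by rewrite ltnS mdegD leq_addl.
  rewrite pscoefE (bigD1 (BMultinom lt_ad, BMultinom lt_bd)) //= big1 => [|k].
    by rewrite addr0 mulf_neq0.
  case/andP=> /eqP abk neq_k.
  case: (ltgtP (k.1 : 'X_{1..n}) a) => [/lt_fa->|lt_ak|eq_ka]; first by rewrite mul0r.
    case: (ltP (k.2 : 'X_{1..n}) b) => [/lt_gb->|le_bk]; first by rewrite mulr0.
    by move: (ltmc_le_add lt_ak le_bk); rewrite -[X in (_ < X)%O]abk ltxx.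
  have eq_kb : (k.2 : 'X_{1..n}) = b by apply/eqP; rewrite -(eqm_add2l a) -{1}eq_ka -abk.
  case/negP: neq_k; apply/eqP; case: (k) eq_ka eq_kb => k1 k2 /= eq1 eq2.
  by congr (_, _); apply/val_inj.
move=> m lt_m; rewrite pscoefE big1 // => k /eqP mE.
case: (ltP (k.1 : 'X_{1..n}) a) => [/lt_fa->|le_ak]; first by rewrite mul0r.
case: (ltP (k.2 : 'X_{1..n}) b) => [/lt_gb->|le_bk]; first by rewrite mulr0.
by move: (lem_add le_ak le_bk); rewrite -mE leNgt lt_m.
Qed.

(** The monomial order compares degrees before anything else, so the degree of the lowest monomial
    is the order of [f]; as lowest monomials add up under products, so do orders. *)
Definition exact_ord e f := exists2 m, lowest f m & mdeg m = e.

Lemma exact_ordM d e f g : exact_ord d f -> exact_ord e g -> exact_ord (d + e) (f * g).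
Proof.
by move=> [a fa <-] [b gb <-]; exists (a + b)%MM; [apply: lowestM|rewrite mdegD].
Qed.

Lemma exact_ord_ex f : f != 0 -> exists e, exact_ord e f.
Proof. by move=> /mps_lowest[m m1 m2]; exists (mdeg m), m. Qed.

Lemma exact_ord_neq0 e f : exact_ord e f -> f != 0.
Proof. by move=> [m [nz _] _]; apply: contraNneq nz => ->. Qed.

Lemma exact_ord_ge e f : exact_ord e f -> ord_ge e f.
Proof. by move=> [m [_ lt_m] <-] k km; apply: lt_m; apply: lt_mdeg_ltmc. Qed.

Lemma ord_ge_exact d e f : ord_ge d f -> exact_ord e f -> (d <= e)%N.
Proof.
by move=> fd [m [nz _] <-]; rewrite leqNgt; apply: contra nz => /fd->.
Qed.

Lemma exact_ordP e f m : ord_ge e f -> pscoef f m != 0 -> mdeg m = e -> exact_ord e f.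
Proof.
move=> fe nz me; have f0 : f != 0 by apply: contraNneq nz => ->.
have [k [nzk ltk]] := mps_lowest f0; exists k => //.
apply/eqP; rewrite eqn_leq; apply/andP; split; last first.
  by rewrite leqNgt; apply: contra nzk => /fe->.
by rewrite leqNgt -me; apply: contra nz => /lt_mdeg_ltmc/ltk->.
Qed.

Lemma exact_ord1 : exact_ord 0 1.
Proof. by apply: (@exact_ordP 0 1 0%MM) => //; rewrite ?mdeg0 // pscoef1 eqxx oner_neq0. Qed.

(** Order at least [d] in the fraction field. The order of the denominator must be exact for the
    quotient to be bounded from below. *)
Definition Val d F := exists a b e,
  [/\ exact_ord e b, ord_ge (d + e) a & F = tofrac a / tofrac b].

Lemma Val_tofrac d f : ord_ge d f -> Val d (tofrac f).
Proof.
by move=> fd; exists f, 1, 0%N; rewrite addn0 tofrac1 divr1; split => //; apply: exact_ord1.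
Qed.

Lemma Val_div e f g : ord_ge e f -> exact_ord e g -> Val 0 (tofrac f / tofrac g).
Proof. by move=> fe ge; exists f, g, e. Qed.

Lemma ValW d e F : (d <= e)%N -> Val e F -> Val d F.
Proof.
move=> de [a [b [k [bk ak ->]]]]; exists a, b, k; split=> //.
by apply: ord_geW ak; rewrite leq_add2r.
Qed.

Lemma Val0 d : Val d 0.
Proof. by rewrite -(tofrac0 (mps n R)); apply: Val_tofrac. Qed.

Lemma ValM d e F G : Val d F -> Val e G -> Val (d + e) (F * G).
Proof.
move=> [a [b [k [bk ak ->]]]] [a' [b' [k' [bk' ak' ->]]]].
exists (a * a'), (b * b'), (k + k')%N; split.
- exact: exact_ordM.
- by rewrite addnACA; apply: ord_geM.
by rewrite !tofracM mulf_div.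
Qed.

Lemma ValD d F G : Val d F -> Val d G -> Val d (F + G).
Proof.
move=> [a [b [k [bk ak ->]]]] [a' [b' [k' [bk' ak' ->]]]].
exists (a * b' + a' * b), (b * b'), (k + k')%N; split.
- exact: exact_ordM.
- apply: ord_geD; first by rewrite addnA; apply: ord_geM => //; apply: exact_ord_ge.
  by rewrite (addnC k) addnA; apply: ord_geM => //; apply: exact_ord_ge.
by rewrite tofracD !tofracM addf_div ?tofrac_eq0 ?(exact_ord_neq0 bk) ?(exact_ord_neq0 bk').
Qed.

Lemma ValN d F : Val d F -> Val d (- F).
Proof.
move=> [a [b [k [bk ak ->]]]]; exists (- a), b, k; split=> //; first exact: ord_geN.
by rewrite tofracN mulNr.
Qed.

Lemma Val_sum d (I : Type) (r : seq I) (P : pred I) (h : I -> {fraction mps n R}) :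
  (forall i, P i -> Val d (h i)) -> Val d (\sum_(i <- r | P i) h i).
Proof. by move=> hP; elim/big_ind: _ => //; [apply: Val0|apply: ValD]. Qed.

Lemma Val1 : Val 0 1.
Proof. by rewrite -(tofrac1 (mps n R)); apply: Val_tofrac. Qed.

Lemma Val_prod (I : Type) (r : seq I) (P : pred I) (h : I -> {fraction mps n R}) :
  (forall i, P i -> Val 0 (h i)) -> Val 0 (\prod_(i <- r | P i) h i).
Proof.
move=> hP; elim/big_ind: _ => //; first exact: Val1.
by move=> F G F0 G0; rewrite -[0%N]addn0; apply: ValM.
Qed.

(** If [F = p / q] with [p] of exact order [e], a representation [a / b] of order [e.+1] gives
    [p * b = a * q], whose right side has too large an order. *)
Lemma Val_eq0 F : (forall d, Val d F) -> F = 0.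
Proof.
move=> FV; have [p [q [e0 [qe _ FE]]]] := FV 0%N.
have [p0|p0] := eqVneq p 0; first by rewrite FE p0 tofrac0 mul0r.
have [e pe] := exact_ord_ex p0.
have [a [b [k [bk ak Fab]]]] := FV e.+1.
have nq := exact_ord_neq0 qe; have nb := exact_ord_neq0 bk.
have E : p * b = a * q.
  apply/eqP; rewrite -tofrac_eq !tofracM; apply/eqP.
  by move: Fab; rewrite FE => /eqP; rewrite eqr_div ?tofrac_eq0 // => /eqP.
have := ord_ge_exact (ord_geM ak (exact_ord_ge qe)); rewrite -E => /(_ _ (exact_ordM pe bk)).
lia.
Qed.

Lemma Val_tofrac_inv d f : Val d (tofrac f) -> ord_ge d f.
Proof.
have [->//|f0] := eqVneq f 0.
have [e fe] := exact_ord_ex f0 => -[a [b [k [bk ak Fab]]]].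
have nb := exact_ord_neq0 bk.
have E : f * b = a.
  apply/eqP; rewrite -tofrac_eq tofracM; apply/eqP.
  by rewrite Fab divfK ?tofrac_eq0.
have := ord_ge_exact ak; rewrite -E => /(_ _ (exact_ordM fe bk)).
rewrite leq_add2r => de; apply: ord_geW de _; exact: exact_ord_ge.
Qed.

Lemma mpsC_mulE c f m : pscoef (mpsC n c * f) m = c * pscoef f m.
Proof.
have -> : mpsC n c * f = mps_mul (mpsC n c) f by [].
rewrite (@mps_mulE _ _ _ _ c%:MP (mps_trunc (mdeg m).+1 f)).
- by rewrite mcoeffCM mps_truncE.
- by move=> k _; rewrite mcoeffC mulr_natr.
by move=> k km; rewrite mps_truncE.
Qed.

Lemma ord_ge_mpsX i : ord_ge 1 (mpsX R i).
Proof.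
move=> m; rewrite ltnS leqn0 mdeg_eq0 => /eqP -> /=.
by case: eqP => // /(congr1 mdeg); rewrite mdeg0 mdeg1.
Qed.

End Valuation.

(** * Divisibility by the Vandermonde product *)

Section Polynomiality.
Variables (n : nat) (R : idomainType).

Definition mps_of_mpoly (p : {mpoly R[n]}) : mps n R := Mps (fun m => p@_m).

Fact mps_of_mpoly_is_zmod_morphism : zmod_morphism mps_of_mpoly.
Proof. by move=> p q; apply/mpsP => m; rewrite /= mcoeffB. Qed.

Fact mps_of_mpoly_is_monoid_morphism : monoid_morphism mps_of_mpoly.
Proof.
split=> [|p q]; first by apply/mpsP => m; rewrite /= mcoeff1.
by apply/mpsP => m; rewrite [RHS](@mps_mulE _ _ _ _ p q).
Qed.

HB.instance Definition _ := GRing.isZmodMorphism.Build _ _ mps_of_mpoly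
  mps_of_mpoly_is_zmod_morphism.
HB.instance Definition _ := GRing.isMonoidMorphism.Build _ _ mps_of_mpoly
  mps_of_mpoly_is_monoid_morphism.

Lemma mps_of_mpolyC c : mps_of_mpoly c%:MP = mpsC n c.
Proof. by apply/mpsP => m; rewrite /= mcoeffC mulr_natr. Qed.

Lemma mps_of_mpolyX i : mps_of_mpoly 'X_i = mpsX R i.
Proof. by apply/mpsP => m; rewrite /= mcoeffX eq_sym. Qed.

Definition ident_tuple (i j : 'I_n) : n.-tuple {mpoly R[n]} :=
  [tuple 'X_(if k == i then j else k) | k < n].

Notation ident i j := (comp_mpoly (ident_tuple i j)).

Lemma identX i j k : ident i j 'X_k = 'X_(if k == i then j else k).
Proof. by rewrite comp_mpolyXU -tnth_nth tnth_mktuple. Qed.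

Lemma ident_dvd i j (p : {mpoly R[n]}) :
  exists q, p - ident i j p = ('X_i - 'X_j) * q.
Proof.
elim/mpolyind: p => [|c m p _ _ [q IH]].
  by exists 0; rewrite comp_mpoly0 subrr mulr0.
suff [r rE] : exists r, 'X_[m] - ident i j 'X_[m] = ('X_i - 'X_j) * r.
  exists (c *: r + q); rewrite comp_mpolyD comp_mpolyZ opprD addrACA IH -scalerBr rE.
  by rewrite mulrDr scalerAr.
rewrite mpolyXE_id rmorph_prod /=.
elim/big_ind2: _ => [|a b a' b' [r rE] [r' rE']|k _].
- by exists 0; rewrite subrr mulr0.
- exists (r * a' + b * r'); rewrite mulrDr mulrA -rE [in RHS]mulrCA -rE'; ring.
rewrite rmorphXn /= identX; case: eqP => [->|_]; last by exists 0; rewrite subrr mulr0.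
by rewrite subrXX; eexists.
Qed.

(** Factors are split off one at a time. Replacing x_i by x_j does not annihilate the factor of any
    other increasing pair, so the cofactor itself must vanish and [ident_dvd] supplies the next
    factor. *)
Lemma vanish_dvd_pairs (s : seq ('I_n * 'I_n)) (p : {mpoly R[n]}) :
    uniq s -> all (fun ij : 'I_n * 'I_n => (ij.1 < ij.2)%N) s ->
    (forall i j, i != j -> ident i j p = 0) ->
  exists q, p = (\prod_(ij <- s) ('X_(ij.1) - 'X_(ij.2))) * q.
Proof.
elim: s => [|[i j] s IH] /=; first by exists p; rewrite big_nil mul1r.
move=> /andP[ijs us] /andP[ij sl] p0; have [q pE] := IH us sl p0.
have nij : i != j by rewrite neq_ltn ij.
have q0 : ident i j q = 0.
  have := p0 i j nij; rewrite pE rmorphM rmorph_prod /= => /eqP.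
  rewrite mulf_eq0 => /orP[|/eqP //].
  rewrite prodf_seq_eq0 => /hasP[[k l] kls /=].
  rewrite comp_mpolyB !identX subr_eq0 => /eqP e.
  have kl : (k < l)%N := allP sl _ kls.
  have := congr1 (mcoeff U_(if k == i then j else k)) e.
  rewrite !mcoeffXU eqxx; case: eqP => [e'|_ /eqP]; last by rewrite oner_eq0.
  move: e' ijs; case: (eqVneq l i) => [li|li]; case: (eqVneq k i) => [ki|ki] e' ijs _.
  - by rewrite li ki ltnn in kl.
  - by subst; rewrite ltnNge (ltnW ij) in kl.
  - by subst; rewrite kls in ijs.
  by rewrite e' ltnn in kl.
have [r qE] := ident_dvd i j q.
by exists r; rewrite big_cons pE -[q in LHS](subr0) -q0 qE /=; ring.
Qed.

End Polynomiality.

(** Both products are Vandermonde determinants, taken at [- z] to obtain the differences in this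
    order; [w] permutes the columns. *)
Lemma prod_diff_perm (K : comNzRingType) N (z : 'I_N -> K) (w : 'S_N) :
  \prod_(i < N) \prod_(j < N | (i < j)%N) (z (w i) - z (w j)) =
  (-1) ^+ w * \prod_(i < N) \prod_(j < N | (i < j)%N) (z i - z j).
Proof.
have detE y : \det (Vandermonde N (\row_j - y j)) =
    \prod_(i < N) \prod_(j < N | (i < j)%N) (y i - y j) :> K.
  rewrite det_Vandermonde; apply: eq_bigr => i _; apply: eq_bigr => j _.
  by rewrite !mxE opprK addrC.
rewrite -(detE (z \o w)) -detE.
have -> : Vandermonde N (\row_j - (z \o w) j) = col_perm w (Vandermonde N (\row_j - z j)).
  by apply/matrixP => i j; rewrite !mxE.
by rewrite col_permE det_mulmx det_perm odd_permV mulrC.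
Qed.

(** * Order estimates for the partial sums *)

Section Estimates.
Variables (N : nat) (R : fieldType) (tau : R).
Hypotheses (tau0 : tau != 0) (taun : forall i, 1 - tau ^+ i.+1 != 0).

Definition phi : {mpoly R[N]} -> {fraction mps N R} := @tofrac _ \o @mps_of_mpoly N R.
HB.instance Definition _ := GRing.RMorphism.on phi.
(** A morphism from the field of constants: whatever comes from [R], inverses included, has order at
    least 0. *)
Definition kappa : R -> {fraction mps N R} := phi \o @mpolyC N R.
HB.instance Definition _ := GRing.RMorphism.on kappa.

Notation K := {fraction mps N R}.
Let t : K := tofrac (mpsC N tau).
Let x (i : 'I_N) : K := tofrac (mpsX R i).

Lemma tE : t = kappa tau. Proof. by rewrite /kappa /phi /= mps_of_mpolyC. Qed.
Lemma xE i : x i = phi 'X_i. Proof. by rewrite /phi /= mps_of_mpolyX. Qed.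

Lemma phi_eq0 p : (phi p == 0) = (p == 0).
Proof.
rewrite tofrac_eq0; apply/eqP/eqP => [e|->]; last by rewrite rmorph0.
by apply/mpolyP => m; have := congr1 (fun f => pscoef f m) e; rewrite mcoeff0.
Qed.

Lemma phi_neq0 (v : 'I_N -> R) p : p.@[v] != 0 -> phi p != 0.
Proof. by rewrite phi_eq0; apply: contraNneq => ->; rewrite meval0. Qed.

Lemma tau1 : tau != 1.
Proof. by have := taun 0; rewrite expr1 subr_eq0 eq_sym. Qed.

Lemma t_neq0 : t != 0. Proof. by rewrite tE fmorph_eq0. Qed.
Lemma t_neq1 : t != 1. Proof. by rewrite tE fmorph_eq1 tau1. Qed.
Lemma t_pow i : 1 - t ^+ i.+1 != 0.
Proof. by rewrite tE -rmorphXn -(rmorph1 kappa) -rmorphB fmorph_eq0. Qed.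

Lemma generic_x A : generic t x A.
Proof.
split=> [i _|i j _ _|i j _ _|i j _ _|i j _ _].
- by rewrite xE (phi_neq0 (v := fun=> 1)) // mevalXU oner_neq0.
- move=> e; apply/eqP; apply: contraT => ij.
  have := @phi_neq0 (fun k => (k == i)%:R) ('X_i - 'X_j).
  rewrite mevalB !mevalXU /= eqxx (eq_sym j) (negPf ij) subr0 oner_neq0 => /(_ isT).
  by rewrite rmorphB /= -!xE e subrr eqxx.
- rewrite !xE -rmorphM -(rmorph1 phi) -rmorphB (phi_neq0 (v := fun=> 0)) //.
  by rewrite mevalB mevalM !mevalXU meval1 mulr0 subr0 oner_neq0.
- rewrite tE !xE /kappa /= -!rmorphM -(rmorph1 phi) -rmorphB (phi_neq0 (v := fun=> 0)) //.
  by rewrite mevalB !mevalM !mevalXU meval1 !mulr0 subr0 oner_neq0.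
rewrite tE !xE /kappa /= -rmorphM -rmorphB.
have [->|ij] := eqVneq i j.
  rewrite (phi_neq0 (v := fun=> 1)) // mevalB mevalM !mevalXU mevalC mulr1.
  by rewrite subr_eq0 eq_sym tau1.
rewrite (phi_neq0 (v := fun k => (k == i)%:R)) // mevalB mevalM !mevalXU /= eqxx.
by rewrite (eq_sym j) (negPf ij) mulr0 subr0 oner_neq0.
Qed.

Lemma Val_phi p : Val 0 (phi p). Proof. exact: Val_tofrac. Qed.
Lemma Val_kappa c : Val 0 (kappa c). Proof. exact: Val_phi. Qed.
Lemma Val_x i : Val 1 (x i). Proof. by apply: Val_tofrac; apply: ord_ge_mpsX. Qed.

Lemma Val_kr i j : i != j -> Val 0 (kr t (x i) (x j)).
Proof.
move=> ij; rewrite /kr tE /kappa /=.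
have -> : x i - phi tau%:MP * x j = tofrac (mpsX R i - mpsC N tau * mpsX R j).
  by rewrite tofracB tofracM -mps_of_mpolyC.
rewrite -tofracB; apply: (@Val_div _ _ 1).
  apply: ord_geD; first exact: ord_ge_mpsX.
  by apply: ord_geN; rewrite -[1%N]add0n; apply: ord_geM => //; apply: ord_ge_mpsX.
apply: (@exact_ordP _ _ _ _ U_(i)%MM); last exact: mdeg1.
  by apply: ord_geD; [|apply: ord_geN]; apply: ord_ge_mpsX.
rewrite pscoefD pscoefN /= eqxx (_ : (U_(i)%MM == U_(j)%MM) = false) ?subr0 ?oner_neq0 //.
by apply/eqP => /mnmP/(_ i); rewrite !mnmE eqxx eq_sym (negPf ij).
Qed.

Lemma Val_fr i j : Val 0 (fr t (x i) (x j)).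
Proof.
rewrite /fr tE !xE /kappa /= -!rmorphM -(rmorph1 phi) -!rmorphB /phi /=.
apply: (@Val_div _ _ 0) => //; apply: (@exact_ordP _ _ _ _ 0%MM); rewrite ?mdeg0 //.
rewrite /= mcoeffB mcoeff1 eqxx -mpolyXD mcoeffX.
rewrite (_ : (_ == 0%MM) = false) ?subr0 ?oner_neq0 //.
by apply/eqP => /(congr1 mdeg); rewrite mdegD !mdeg1 mdeg0.
Qed.

Lemma Val0M F G : Val 0 F -> Val 0 G -> Val 0 (F * G : K).
Proof. by move=> F0 G0; rewrite -[0%N]addn0; apply: ValM. Qed.

Lemma Val_krset (A B : {set 'I_N}) : [disjoint A & B] -> Val 0 (krset t x A B).
Proof.
move=> AB; apply: Val_prod => i iA; apply: Val_prod => j jB; apply: Val_kr.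
by apply: contraTneq jB => <-; rewrite (disjointFr AB iA).
Qed.

Lemma disjointD (S T : {set 'I_N}) : [disjoint S & T :\: S].
Proof. by rewrite disjoint_sym disjoints_subset; apply/subsetP => j; rewrite !inE => /andP[]. Qed.

Lemma Val_hlF beta T : (forall r, Val 0 (beta r)) -> Val 0 (hlF t x beta T).
Proof.
move=> b0; apply: Val_sum => S _; apply: Val0M => //; apply: Val0M.
  exact/Val_krset/disjointD.
by apply: Val_prod => i _; apply: Val_prod => j _; apply: Val_fr.
Qed.

Lemma Val_hlsym l A : Val 0 (hlsym t x l A).
Proof.
elim: l A => [|a l IH] A /=; first exact: Val1.
apply: Val_sum => i _; apply: Val0M => //; apply: Val0M.
  by rewrite xE -rmorphXn; apply: Val_phi.
by apply: Val_prod => j; rewrite !inE => /andP[ji _]; apply: Val_kr; rewrite eq_sym.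
Qed.

Lemma Val_xX i a : Val a (x i ^+ a).
Proof.
elim: a => [|a IH]; first exact: Val1.
by rewrite exprS -add1n; apply: ValM => //; apply: Val_x.
Qed.

Lemma Val_hlsym_head a l A : Val a (hlsym t x (a :: l) A).
Proof.
apply: Val_sum => i _; rewrite -[X in Val X]addn0; apply: ValM; last exact: Val_hlsym.
rewrite -[X in Val X]addn0; apply: ValM; first exact: Val_xX.
by apply: Val_prod => j; rewrite !inE => /andP[ji _]; apply: Val_kr; rewrite eq_sym.
Qed.

Lemma hl_v_kappa m : hl_v t m = kappa (hl_v tau m).
Proof.
rewrite tE /hl_v rmorph_prod; apply: eq_bigr => i _.
by rewrite fmorph_div !rmorphB !rmorph1 rmorphXn.
Qed.

Lemma vprod_kappa M la : vprod t M la = kappa (vprod tau M la).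
Proof. by rewrite /vprod rmorph_prod; apply: eq_bigr => i _; apply: hl_v_kappa. Qed.

Lemma b_el_kappa la : b_el t la = kappa (b_el tau la).
Proof.
rewrite tE /b_el rmorph_prod; apply: eq_bigr => i _; rewrite rmorph_prod.
by apply: eq_bigr => j _; rewrite rmorphB rmorph1 rmorphXn.
Qed.

Lemma gprod_kappa ups m : gprod t (kappa ups) m = kappa (gprod tau ups m).
Proof.
rewrite tE /gprod rmorph_prod; apply: eq_bigr => j _.
by rewrite rmorphB rmorph1 rmorphM rmorphXn.
Qed.

Lemma g_even_kappa ups m : g_even t (kappa ups) m = kappa (g_even tau ups m).
Proof.
rewrite tE /g_even; case: ifP => _; first by rewrite rmorph0.
rewrite rmorph_prod; apply: eq_bigr => j _.
by rewrite rmorphB rmorph1 rmorphM rmorphXn.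
Qed.

Lemma beta_u_kappa ups m : beta_u t (kappa ups) m = kappa (beta_u tau ups m).
Proof.
rewrite /beta_u hl_v_kappa rmorphM rmorph_sum; congr (_ * _); apply: eq_bigr => r _.
rewrite !hl_v_kappa g_even_kappa !rmorphM !fmorphV; congr (_ / _ * _).
by rewrite tE /beta1 rmorph_prod; apply: eq_bigr => i _; rewrite rmorphN rmorphXn.
Qed.

(** Both parts obey the same column recursion, so the difference is a sum over even [S] of
    differences at u = t, each multiplied by the product of the x_i in [S]. For nonempty [S] this
    product raises the order by at least one; for empty [S] the difference is zero. The value [ups]
    is general because the hypothesis is applied at [tau]. *)
Lemma Val_column_sum (ups : R) d (T : {set 'I_N}) : ~~ odd #|T| ->
  Val d (hlF t x (beta_u t (kappa ups)) T -
         \sum_(la <- evcols d #|T|) hlw t (kappa ups) #|T| la * hlP t x la T).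
Proof.
have t0 := t_neq0; have t1 := t_neq1; have tn := t_pow.
have gx := generic_x.
elim: d ups T => [|d IH] ups T eT.
  have [x0 xi _ _ _] := gx T.
  rewrite /= big_seq1 hlP_nil // gprod_kappa; apply: ValD.
    by apply: Val_hlF => r; rewrite beta_u_kappa; apply: Val_kappa.
  by apply: ValN; apply: Val_kappa.
rewrite (hlF_column t0 t1 tn) // big_evcols.
pose H (S : {set 'I_N}) := g_even t (kappa ups) (#|T| - #|S|) * krset t x S (T :\: S).
have -> : \sum_(l < #|T|.+1 | ~~ odd l) \sum_(mu <- evcols d l)
     hlw t (kappa ups) #|T| (colup l mu) * hlP t x (colup l mu) T =
   \sum_(S : {set 'I_N} | (S \subset T) && ~~ odd #|S|) H S * (\prod_(i in S) x i *
     \sum_(mu <- evcols d #|S|) hlw t t #|S| mu * hlP t x mu S).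
  rewrite [RHS](partition_big (fun S : {set 'I_N} => inord #|S| : 'I_#|T|.+1)
     (fun l : 'I_#|T|.+1 => ~~ odd l)) /=; last first.
    by move=> S /andP[ST eS]; rewrite inordK // ltnS subset_leq_card.
  apply: eq_bigr => l el.
  rewrite (eq_bigl (fun S : {set 'I_N} => (S \subset T) && (#|S| == l))); last first.
    move=> S; rewrite -val_eqE -andbA; apply: andb_id2l => ST /=.
    rewrite inordK ?ltnS ?subset_leq_card //.
    by case: eqP => [->|]; rewrite ?el ?andbF ?andbT.
  transitivity (\sum_(S : {set 'I_N} | (S \subset T) && (#|S| == l))
     \sum_(mu <- evcols d l) H S * (\prod_(i in S) x i * (hlw t t #|S| mu * hlP t x mu S))).
    rewrite exchange_big /= [LHS]big_seq [RHS]big_seq; apply: eq_bigr => mu.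
    rewrite evcolsP => /andP[/and3P[/andP[_ mu0] ml _] _].
    by rewrite (hlP_colup t0 t1 tn) // -ltnS.
  apply: eq_bigr => S /andP[_ /eqP ->].
  by rewrite -mulr_sumr -mulr_sumr.
rewrite -sumrB; apply: Val_sum => S /andP[ST eS].
rewrite -mulrBr -mulrBr.
have [S0|S0] := eqVneq S set0.
  have [x0 xi _ _ _] := gx S.
  rewrite S0 hlF0 ?beta_u0 // cards0 (_ : evcols d 0 = [:: [::]]); last first.
    by elim: (d) => //= d' ->.
  rewrite big_seq1 -(@cards0 'I_N) -S0 hlP_nil // S0 cards0 /gprod big_geq //.
  by rewrite subrr !mulr0; apply: Val0.
rewrite -[d.+1]add0n; apply: ValM.
  apply: Val0M; first by rewrite g_even_kappa; apply: Val_kappa.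
  exact/Val_krset/disjointD.
rewrite -add1n; apply: ValM; last by rewrite tE; have := IH tau S eS; rewrite tE.
case/set0Pn: S0 => i iS; rewrite (big_setD1 i) //= -[1%N]addn0; apply: ValM.
  exact: Val_x.
by apply: Val_prod => j _; apply: ValW (Val_x j).
Qed.

End Estimates.

(** * The symmetrization is a polynomial *)

Section Regularity.
Variables (N : nat) (R : fieldType) (tau : R).
Hypotheses (tau0 : tau != 0) (taun : forall i, 1 - tau ^+ i.+1 != 0).
Notation K := {fraction mps N R}.
Let t : K := tofrac (mpsC N tau).
Let x (i : 'I_N) : K := tofrac (mpsX R i).

(* The Vandermonde product times the Hall-Littlewood symmetrization. *)
Definition alt_mpoly (e : nat -> nat) (y : 'I_N -> {mpoly R[N]}) : {mpoly R[N]} :=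
  \sum_(w : 'S_N) (-1) ^+ w * (\prod_(i < N) y (w i) ^+ e i *
    \prod_(i < N) \prod_(j < N | (i < j)%N) (y (w i) - tau%:MP * y (w j))).

(** Composition with the transposition of [i] and [j] matches odd with even permutations, with equal
    products and opposite signs. *)
Lemma alt_mpoly_eq0 e y i j : i != j -> y i = y j -> alt_mpoly e y = 0.
Proof.
move=> ij yij; rewrite /alt_mpoly (bigID (@odd_perm _)) /=.
apply: canLR (subrK _) _; rewrite add0r -sumrN.
rewrite (reindex_inj (mulIg (tperm i j))).
have yt k : y (tperm i j k) = y k by case: tpermP => [->|->|].
apply: eq_big => [s|s _]; first by rewrite odd_permM odd_tperm ij addbT.
rewrite odd_permM odd_tperm ij addbT.
have -> : \prod_(k < N) y ((s * tperm i j)%g k) ^+ e k = \prod_(k < N) y (s k) ^+ e k.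
  by apply: eq_bigr => k _; rewrite permM yt.
have -> : \prod_(k < N) \prod_(l < N | (k < l)%N)
     (y ((s * tperm i j)%g k) - tau%:MP * y ((s * tperm i j)%g l)) =
   \prod_(k < N) \prod_(l < N | (k < l)%N) (y (s k) - tau%:MP * y (s l)).
  by apply: eq_bigr => k _; apply: eq_bigr => l _; rewrite !permM !yt.
by case: (odd_perm s); rewrite /= ?expr0 ?expr1 ?mulN1r ?mul1r ?opprK.
Qed.

Lemma hlsym_alt e :
  hlsym t x (mkseq e N) setT * \prod_(i < N) \prod_(j < N | (i < j)%N) (x i - x j) =
  phi (alt_mpoly e (fun i => 'X_i)).
Proof.
have gx := generic_x taun.
have idT : (fun i : 'I_N => i) @: setT = setT by rewrite imset_id.
rewrite -[in hlsym _ _ _ _]idT -(hlsym_perm t x e (f := fun i => i)) //.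
rewrite mulr_suml rmorph_sum; apply: eq_bigr => w _.
set D := \prod_(i < N) \prod_(j < N | _) (x i - x j).
rewrite !rmorphM rmorph_sign /=.
have -> : phi (\prod_(i < N) 'X_(w i) ^+ e i) = \prod_(i < N) x (w i) ^+ e i.
  by rewrite rmorph_prod; apply: eq_bigr => i _; rewrite rmorphXn /= -xE.
have -> : phi (\prod_(i < N) \prod_(j < N | (i < j)%N) ('X_(w i) - tau%:MP * 'X_(w j))) =
    \prod_(i < N) \prod_(j < N | (i < j)%N) (x (w i) - t * x (w j)).
  rewrite rmorph_prod; apply: eq_bigr => i _; rewrite rmorph_prod; apply: eq_bigr => j _.
  by rewrite rmorphB rmorphM /= -!xE /t tE.
rewrite -mulrA [RHS]mulrCA; congr (_ * _).
have D0 : D != 0.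
  apply/prodf_neq0 => i _; apply/prodf_neq0 => j ij.
  by apply: (generic_neq (gx N setT)); rewrite ?inE // neq_ltn ij.
rewrite /kr; under eq_bigr do rewrite prodf_div.
rewrite prodf_div prod_diff_perm -/D.
by rewrite invfM invr_sign mulrA divfK // mulrC.
Qed.

Lemma hlsym_regular e : exists q, hlsym t x (mkseq e N) setT = phi q.
Proof.
pose s := [seq ij : 'I_N * 'I_N <- enum {: 'I_N * 'I_N} | (ij.1 < ij.2)%N].
have [||i j ij|q qE] := @vanish_dvd_pairs N R s (alt_mpoly e (fun i => 'X_i)).
- by rewrite filter_uniq ?enum_uniq.
- exact: filter_all.
- rewrite [LHS](_ : _ = alt_mpoly e (fun k => 'X_(if k == i then j else k))).
    by apply: (@alt_mpoly_eq0 e _ i j ij); rewrite eqxx eq_sym (negPf ij).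
  rewrite /alt_mpoly rmorph_sum; apply: eq_bigr => w _.
  rewrite !rmorphM rmorph_sign !rmorph_prod; congr (_ * (_ * _)).
    by apply: eq_bigr => k _; rewrite rmorphXn /= identX.
  apply: eq_bigr => k _; rewrite rmorph_prod; apply: eq_bigr => l _.
  by rewrite rmorphB rmorphM /= !identX comp_mpolyC.
exists q; have gx := generic_x taun.
have D0 : \prod_(i < N) \prod_(j < N | (i < j)%N) (x i - x j) != 0.
  apply/prodf_neq0 => i _; apply/prodf_neq0 => j ij.
  by apply: (generic_neq (gx N setT)); rewrite ?inE // neq_ltn ij.
apply: (mulIf D0); rewrite hlsym_alt qE rmorphM mulrC; congr (_ * _).
rewrite rmorph_prod /s big_filter big_enum_cond /= pair_big_dep /=.
by apply: eq_bigr => ij _; rewrite rmorphB /= -!xE.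
Qed.


End Regularity.

(** * Assembly of the formal sum *)

Lemma big_even_partition (V : nmodType) d M (B : seq (seq nat)) (G : seq nat -> V) :
    uniq B -> {subset evcols d M <= B} ->
    (forall la, even_partition M la -> (d < head 0%N la)%N -> G la = 0) ->
  \sum_(la <- B | even_partition M la) G la = \sum_(la <- evcols d M) G la.
Proof.
move=> uB sB G0; rewrite (bigID (fun la => head 0%N la <= d)%N) /=.
rewrite [X in _ + X]big1 ?addr0; last by move=> la /andP[Pla]; rewrite -ltnNge; apply: G0.
rewrite -big_filter; apply: perm_big; apply: uniq_perm.
- exact: filter_uniq.
- exact: evcols_uniq.
move=> la; rewrite mem_filter -evcolsP.
by apply/andP/idP => [[]|laE] //; split=> //; apply: sB.
Qed.

Lemma evcols_le d e M : (d <= e)%N -> {subset evcols d M <= evcols e M}.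
Proof. by move=> de la; rewrite !evcolsP => /andP[-> /leq_trans]; apply. Qed.

Theorem theorem7 (n : nat) :
  let t := t_ (2 * n) in
  let u := u_ (2 * n) in
  let x := @x_ (2 * n) in
  formal_sum
    (fun l : seq nat => [&& is_partition l, (size l <= 2 * n)%N
                          & all (fun p => ~~ odd p) (conj_partition l)])
    (fun l : seq nat =>
       (\prod_(2 <= j < (mult (2 * n) l 0).+1 | ~~ odd j)
          (1 - u * t ^+ (j - 2)))
       * b_el t l * hall_littlewood x t l)
    ((\prod_(i < 2 * n) \prod_(j < 2 * n | (i < j)%N)
        ((1 - t * x i * x j) / (x i - x j)))
     * pfaffian (antisym_mx (fun i j =>
         ((x i - x j) * (1 - u + (u - t) * x i * x j))
         / ((1 - x i * x j) * (1 - t * x i * x j))))).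
Proof.
move=> t u x; set N := (2 * n)%N in t u x *.
pose tau : Qtu := tofrac ('X%:P); pose ups : Qtu := tofrac 'X.
have eN : ~~ odd N by rewrite /N mul2n odd_double.
have tau0 : tau != 0 by rewrite tofrac_eq0 polyC_eq0 polyX_eq0.
have taun i : 1 - tau ^+ i.+1 != 0.
  rewrite -tofracXn -(tofrac1 _) -tofracB tofrac_eq0 -rmorphXn -(rmorph1 polyC) -rmorphB.
  rewrite polyC_eq0 -size_poly_eq0 -opprB size_polyN.
  by rewrite (size_XnsubC 1).
have uE : u = kappa N ups by rewrite /kappa /phi /= mps_of_mpolyC.
have gx : forall A, generic t x A := generic_x taun.
have t0 : t != 0 := t_neq0 N tau0.
have t1 : t != 1 := t_neq1 N taun.
have tn : forall i, 1 - t ^+ i.+1 != 0 := t_pow N taun.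
have cT : #|[set: 'I_N]| = N by rewrite cardsT card_ord.
pose F la := hlw t u N la * hlP t x la setT.
(* The order bound by the largest part, which comes from the factor x_i^a in front, leaves finitely
   many partitions for each coefficient. *)
have Freg la : exists f, tofrac f = F la /\ ((size la <= N)%N -> ord_ge (head 0%N la) f).
  have [q qE] := @hlsym_regular N Qtu tau taun (nth 0%N la).
  pose c := gprod tau ups (mult N la 0) * b_el tau la / vprod tau N la.
  have hlwE : hlw t u N la = kappa N (gprod tau ups (mult N la 0) * b_el tau la).
    by rewrite /hlw uE (gprod_kappa N tau) (b_el_kappa N tau) rmorphM.
  have vE : (vprod t N la)^-1 = kappa N (vprod tau N la)^-1.
    by rewrite (vprod_kappa N tau) fmorphV.
  have FE : F la = tofrac (mps_of_mpoly (c%:MP * q)).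
    transitivity (kappa N c * phi q); last by rewrite -[RHS]/(phi (_ * _)) [RHS]rmorphM.
    by rewrite /F hlwE /hlP cT vE qE mulrA [kappa N c]rmorphM.
  exists (mps_of_mpoly (c%:MP * q)); split=> // sla.
  apply: Val_tofrac_inv; rewrite -FE /F hlwE /hlP cT vE.
  rewrite -[X in Val X]add0n; apply: ValM; first exact: Val_kappa.
  rewrite -[X in Val X]add0n; apply: ValM; first exact: Val_kappa.
  have HV M : (size la <= M)%N ->
      Val (head 0%N la) (hlsym t x (mkseq (nth 0%N la) M) setT).
    case: (la) M => [|a l] [|M] // _; [exact: Val_hlsym|exact: Val_hlsym|].
    exact: Val_hlsym_head.
  exact: HV.
have [f fE] := choice Freg.
(* A partition with more than [mdeg m] columns cannot contribute at [m]. *)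
pose s : mps N Qtu := Mps (fun m => \sum_(la <- evcols (mdeg m) N) pscoef (f la) m).
have s_sum d m (B : seq (seq nat)) : (mdeg m <= d)%N -> uniq B ->
    {subset evcols (mdeg m) N <= B} ->
    \sum_(la <- B | even_partition N la) pscoef (f la) m = pscoef s m.
  move=> _ uB sB; apply: big_even_partition => // la /and3P[_ sla _] hla.
  by have [_] := fE la; apply.
have idT : (fun i : 'I_N => i) @: setT = setT by rewrite imset_id.
exists f, s; split.
- move=> la _; have [-> _] := fE la; rewrite /F /hlw /hlP cT; congr (_ * (_ * _)).
  by rewrite -[in LHS]idT -(hlsym_perm t x (nth 0%N la) (f := fun i => i)).
- have RE := @pf_hlF _ N t u (beta_u t u) x t0 t1 (beta_u0 t u) (beta_u_rec u t1 tn) N (fun i => i) eN.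
  have /RE {}RE : injective (fun i : 'I_N => i) by [].
  have {}RE := RE (gx _); rewrite idT in RE.
  rewrite -[RHS]/(_ * pf _) [RHS]RE; apply/eqP; rewrite -subr_eq0; apply/eqP.
  apply: Val_eq0 => d.
  (* Both differences have order at least [d]: the first because partitions with more than [d]
     columns do not reach degrees below [d], the second by [Val_column_sum]. *)
  have -> : tofrac s - hlF t x (beta_u t u) setT =
      tofrac (s - \sum_(la <- evcols d N) f la) -
      (hlF t x (beta_u t u) setT - \sum_(la <- evcols d #|[set: 'I_N]|) F la).
    rewrite cT tofracB rmorph_sum /=.
    rewrite [X in _ - X - _](eq_bigr F) => [|la _]; last by have [] := fE la.
    by rewrite opprB addrA subrK.
  apply: ValD; last first.
    apply: ValN; rewrite /F uE -[X in hlw _ _ X]cT.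
    by apply: Val_column_sum => //; rewrite cT.
  apply: Val_tofrac => m md; rewrite pscoefD pscoefN pscoef_sum.
  rewrite -(@s_sum d m (evcols d N)) ?evcols_uniq ?(ltnW md) //; last exact/evcols_le/ltnW.
  rewrite big_seq_cond [X in _ - X]big_seq (eq_bigl (mem (evcols d N))) ?subrr //.
  by move=> la; rewrite /= evcolsP; case: (even_partition N la); rewrite ?andbT ?andbF.
by move=> m; exists (evcols (mdeg m) N) => B uB sB; apply: (s_sum (mdeg m)).
Qed.
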